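(* Let $\Omega\subset\mathbb R^2$ be a bounded polygon with a polygonal mesh $\mathcal T_h$, and let $\boldsymbol\tau\in\boldsymbol L^2(\Omega;\mathbb S)$ be piecewise smooth with respect to $\mathcal T_h$ (i.e. $\boldsymbol\tau|_K\in\mathcal C^2(\overline K;\mathbb S)$ for each $K\in\mathcal T_h$) such that (i) $\boldsymbol\tau|_K\in\boldsymbol H(\operatorname{div}\operatorname{div},K;\mathbb S)$ for each polygon $K\in\mathcal T_h$; (ii) $(\boldsymbol n^{\intercal}\boldsymbol\tau\boldsymbol n)|_e\in L^2(e)$ is single-valued for each interior edge $e\in\mathcal E_h^i$; (iii) $(\partial_{t_e}(\boldsymbol t^{\intercal}\boldsymbol\tau\boldsymbol n)+\boldsymbol n_e^{\intercal}\operatorname{div}\boldsymbol\tau)|_e\in L^2(e)$ is single-valued for each $e\in\mathcal E_h^i$; (iv) $\boldsymbol\tau(\delta)$ is single-valued for each interior vertex $\delta\in\mathcal V_h^i$. Then $\boldsymbol\tau\in\boldsymbol H(\operatorname{div}\operatorname{div},\Omega;\mathbb S)$.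
   Context: $\mathbb S$ is the space of symmetric real $2\times 2$ matrices. $\operatorname{div}$ of a matrix field is taken row-wise. For a domain $G$, $\boldsymbol H(\operatorname{div}\operatorname{div},G;\mathbb S)=\{\boldsymbol\tau\in\boldsymbol L^2(G;\mathbb S):\operatorname{div}\operatorname{div}\boldsymbol\tau\in L^2(G)\}$, with $\operatorname{div}\operatorname{div}$ in the distributional sense. $\mathcal T_h$ is a shape-regular (conforming) partition of $\Omega$ into polygons, with interior edges $\mathcal E_h^i$ and interior vertices $\mathcal V_h^i$. For each edge $e$ a unit normal $\boldsymbol n_e=(n_1,n_2)^{\intercal}$ is fixed and $\boldsymbol t_e=(-n_2,n_1)^{\intercal}$; $\partial_{t_e}$ is the derivative along $\boldsymbol t_e$. The quantities $\boldsymbol n^{\intercal}\boldsymbol\tau\boldsymbol n$ and $\boldsymbol t^{\intercal}\boldsymbol\tau\boldsymbol n$ on $e$ do not change when $(\boldsymbol n,\boldsymbol t)$ is replaced by $(-\boldsymbol n,-\boldsymbol t)$. A quantity is single-valued on an interior edge (at an interior vertex) if its values computed from all the elements containing that edge (vertex) coincide. *)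

(* Defs.v *)
From HB Require Import structures.
From mathcomp Require Import all_boot all_order all_algebra.
From mathcomp Require Import all_classical all_reals all_analysis.

Set Implicit Arguments.
Unset Strict Implicit.
Unset Printing Implicit Defensive.

Import Order.TTheory GRing.Theory Num.Theory numFieldNormedType.Exports.

Local Open Scope classical_set_scope.
Local Open Scope ring_scope.

Section Plane.
Variable R : realType.

Definition pt := (R * R)%type.

Definition coord (i : 'I_2) (x : pt) : R := if i == 0 then x.1 else x.2.

Definition basis_vec (i : 'I_2) : pt := ((i == 0)%:R, (i == 1)%:R).

Definition dot (u v : pt) : R := \sum_i coord i u * coord i v.

(* u^T M v *)
Definition form (u : pt) (M : 'M[R]_2) (v : pt) : R :=
  \sum_i \sum_j coord i u * M i j * coord j v.

Definition pderiv (i : 'I_2) (f : pt -> R) (x : pt) : R := 'D_(basis_vec i) f x.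

Definition leb2 := (@lebesgue_measure R \x @lebesgue_measure R)%E.

Definition boundary (A : set pt) : set pt := closure A `\` A°.

Definition segment (a b : pt) : set pt :=
  [set (1 - s) *: a + s *: b | s in `[0 : R, 1]].

Definition is_segment (e : set pt) : Prop :=
  exists a b : pt, a != b /\ e = segment a b.

Definition endpoints (e : set pt) : set pt :=
  [set a | exists b : pt, a != b /\ e = segment a b].

(* Open polygonal domain.  Regularity (interior of its closure) rules out slits
   and removed points. *)
Definition polygon (P : set pt) : Prop :=
  [/\ P !=set0, connected P, bounded_set P, regopen P
    & exists S : set (set pt),
        [/\ finite_set S, forall e, S e -> is_segment e
          & boundary P = \bigcup_(e in S) e]].

(* Th is the set of the (open) elements and Eh the set of the (closed) edges.
   An element may have a flat angle at a vertex, so the edges of the elements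
   are part of the data; e in Eh is an edge of K iff it lies in the boundary
   of K. *)
Record polygonal_mesh (Omega : set pt) (Th Eh : set (set pt)) : Prop :=
  PolygonalMesh {
    mesh_finite : finite_set Th /\ finite_set Eh;
    mesh_polygon : forall K, Th K -> polygon K;
    mesh_disjoint : trivIset Th id;
    mesh_cover : closure Omega = \bigcup_(K in Th) closure K;
    mesh_segment : forall e, Eh e -> is_segment e;
    mesh_boundary : forall K, Th K ->
      boundary K = \bigcup_(e in [set e | Eh e /\ e `<=` boundary K]) e;
    mesh_edge : forall e, Eh e -> exists2 K, Th K & e `<=` boundary K;
    (* conformity: two distinct edges meet at most at a common endpoint *)
    mesh_conforming : forall e e', Eh e -> Eh e' -> e <> e' ->
      e `&` e' `<=` endpoints e `&` endpoints e' }.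

Definition vertices (Eh : set (set pt)) : set pt :=
  \bigcup_(e in Eh) endpoints e.

Definition interior_edges (Omega : set pt) (Eh : set (set pt)) : set (set pt) :=
  [set e | Eh e /\ ~ (e `<=` boundary Omega)].

Definition interior_vertices (Omega : set pt) (Eh : set (set pt)) : set pt :=
  [set d | vertices Eh d /\ ~ boundary Omega d].

Definition unit_normal (e : set pt) (n : pt) : Prop :=
  dot n n = 1 /\ forall x y, e x -> e y -> dot n (x - y) = 0.

Definition tangent (n : pt) : pt := (- n.2, n.1).

Definition L2 (G : set pt) (f : pt -> R) : Prop := f \_ G \in Lfun leb2 2%:E.

(* Arclength on e is, up to the constant factor |b - a|, Lebesgue measure in the
   parameter s. *)
Definition L2_edge (e : set pt) (f : pt -> R) : Prop :=
  forall a b : pt, a != b -> e = segment a b ->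
    (fun s : R => f ((1 - s) *: a + s *: b)) \_ `[0, 1]
      \in Lfun (@lebesgue_measure R) 2%:E.

Definition L2_sym (G : set pt) (tau : pt -> 'M[R]_2) : Prop :=
  (forall x, G x -> (tau x)^T = tau x)
  /\ forall i j, L2 G (fun x => tau x i j).

(* C^k(closure K), K open: the partial derivatives of order at most k exist in K
   and have continuous extensions to the closure of K. *)
Fixpoint Ck_closure (k : nat) (K : set pt) (f : pt -> R) : Prop :=
  (exists g : pt -> R,
     {within closure K, continuous g} /\ forall x, K x -> f x = g x)
  /\ (if k is k'.+1 then
        forall i, (forall x, K x -> derivable f x (basis_vec i))
                  /\ Ck_closure k' K (pderiv i f)
      else True).

Fixpoint Ck (k : nat) (f : pt -> R) : Prop :=
  continuous f
  /\ (if k is k'.+1 then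
        forall i, (forall x, derivable f x (basis_vec i)) /\ Ck k' (pderiv i f)
      else True).

(* C_c^oo(G) *)
Definition test_function (G : set pt) (phi : pt -> R) : Prop :=
  [/\ forall k, Ck k phi,
      compact (closure [set x | phi x != 0])
    & closure [set x | phi x != 0] `<=` G].

(* The distribution div div tau on G: two integrations by parts in
   div div tau = sum_(i, j) d_i d_j tau_ij give
   <div div tau, phi> = int_G tau : Hess phi. *)
Definition divdiv_distr (G : set pt) (tau : pt -> 'M[R]_2) (phi : pt -> R) : R :=
  \int[leb2]_(x in G) (\sum_i \sum_j tau x i j * pderiv i (pderiv j phi) x).

Definition Hdivdiv (G : set pt) (tau : pt -> 'M[R]_2) : Prop :=
  L2_sym G tau
  /\ exists2 f : pt -> R, L2 G f
     & forall phi, test_function G phi ->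
         divdiv_distr G tau phi = \int[leb2]_(x in G) (f x * phi x).

Definition row_div (tau : pt -> 'M[R]_2) (x : pt) : pt :=
  (\sum_j pderiv j (fun y => tau y 0 j) x, \sum_j pderiv j (fun y => tau y 1 j) x).

(* Value at x in the closure of K of a function, computed from K. *)
Definition trace_from (K : set pt) (f : pt -> R) (x : pt) : R :=
  lim (f y @[y --> within K (nbhs x)]).

Definition nn_comp (n : pt) (tau : pt -> 'M[R]_2) (x : pt) : R :=
  form n (tau x) n.

(* d_t (t^T tau n) + n^T div tau, for fixed n and t = tangent n *)
Definition tn_div_comp (n : pt) (tau : pt -> 'M[R]_2) (x : pt) : R :=
  'D_(tangent n) (fun y => form (tangent n) (tau y) n) x + dot n (row_div tau x).

Definition L2_single_valued_edge (Th : set (set pt)) (e : set pt)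
    (q : pt -> R) : Prop :=
  (forall K, Th K -> e `<=` closure K -> L2_edge e (trace_from K q))
  /\ forall K K', Th K -> Th K' -> e `<=` closure K -> e `<=` closure K' ->
       forall x, (e `\` endpoints e) x -> trace_from K q x = trace_from K' q x.

Definition single_valued_vertex (Th : set (set pt)) (d : pt)
    (tau : pt -> 'M[R]_2) : Prop :=
  forall K K', Th K -> Th K' -> closure K d -> closure K' d ->
    forall i j, trace_from K (fun x => tau x i j) d
              = trace_from K' (fun x => tau x i j) d.

End Plane.

(* Main.v *)
(* With [q = tau grad phi - (div tau) phi], the product rule gives on each element
   [div q = tau : Hess phi - (div div tau) phi]. Integrating the term [d_1 q_1] along
   horizontal lines and [d_2 q_2] along vertical lines (Fubini), the integral of
   [div q] over the elements becomes a sum over the edges of integrals of jumps of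
   [n . q]. On an edge
     [n . q = (n^T tau n) d_n phi + d_t((t^T tau n) phi)
              - (d_t(t^T tau n) + n . div tau) phi],
   so by (ii) and (iii) only the tangential derivative of the jump of
   [(t^T tau n) phi] is left. Its integral over the edge vanishes, because this jump
   tends to 0 at both endpoints: by (iv) at an interior vertex, and because [phi]
   vanishes near the boundary otherwise. Hence the distributional div div of [tau]
   is the piecewise one, which is bounded. *)

Require Import Defs.
From HB Require Import structures.
From mathcomp Require Import all_boot all_order all_algebra.
From mathcomp Require Import all_classical all_reals all_analysis.
From mathcomp Require Import measurable_realfun ring lra.

Set Implicit Arguments.
Unset Strict Implicit.
Unset Printing Implicit Defensive.

Import Order.TTheory GRing.Theory Num.Theory numFieldNormedType.Exports.
Local Open Scope classical_set_scope.
Local Open Scope ring_scope.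

(** * Integration on the line *)

(** Elements may have holes, reentrant corners and flat angles, so their boundaries come with no
    parametrization or outward normal. Everything is therefore phrased edge by edge: an edge keeps
    its fixed normal [n], and the jump across it is the difference of the limits from its two open
    half-planes ([half_nbhs]). The geometric input is that, near a point of [Omega] in the relative
    interior of an edge, each side is filled by a single element ([half_neighborhood]). The support
    [S] of the test function makes boundary edges harmless: every integrand vanishes off [S], so a
    jump is zero at the points of an edge outside [S], while a point of [S] on an edge lies in
    [Omega] and shows that the edge is interior. Traces are controlled on the open edge only, since
    several elements meet at a vertex; the tangential derivative is therefore integrated over []0,
    1[], with limits at the ends. The values of [derive] at edge points carry no information, so
    densities are set to zero off the elements before they are integrated. *)

(** On an interval whose interior avoids [s], the functions [h] and [dh], extended to the ends by
    their one-sided limits, satisfy the fundamental theorem of calculus; splitting at the points of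
    [s] produces the jumps. *)
Lemma integral_piecewise_derive (R : realType) (h dh hl hr : R -> R)
    (s : seq R) (a b : R) : a < b -> uniq s ->
  (forall x, x \notin s -> is_derive x 1 h (dh x)) ->
  (forall x, x \notin s -> {for x, continuous dh}) ->
  (forall x, cvg (dh y @[y --> x^'+])) ->
  (forall x, cvg (dh y @[y --> x^'-])) ->
  (forall x, h y @[y --> x^'+] --> hr x) ->
  (forall x, h y @[y --> x^'-] --> hl x) ->
  (@lebesgue_measure R).-integrable `[a, b] (EFin \o dh) ->
  \int[lebesgue_measure]_(x in `[a, b]) dh x
    = hl b - hr a - \sum_(x <- s | x \in `]a, b[) (hr x - hl x).
Proof.
move=> + + Dh Cdh dhr dhl hrE hlE.
(* [s'] contains all points of [s] that lie in the current []a, b[]. The induction shrinks [s'] and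
   the interval, while the hypotheses keep referring to the full [s]. *)
have main n : forall s', (size s' <= n)%N -> forall a b : R, a < b -> uniq s' ->
  (forall x, x \in `]a, b[ -> x \notin s' -> x \notin s) ->
  (@lebesgue_measure R).-integrable `[a, b] (EFin \o dh) ->
  \int[lebesgue_measure]_(x in `[a, b]) dh x
    = hl b - hr a - \sum_(x <- s' | x \in `]a, b[) (hr x - hl x).
  elim: n => [|n IHn] s' + {}a {}b ab us' ss' idh.
    rewrite leqn0 => /nilP s'0; rewrite s'0 big_nil subr0.
    have ns x : x \in `]a, b[ -> x \notin s by move=> /ss'; apply; rewrite s'0.
    pose f (x : R) : R := if x == a then lim (dh y @[y --> a^'+]) else
                if x == b then lim (dh y @[y --> b^'-]) else dh x.
    pose F x := if x == a then hr a else if x == b then hl b else h x.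
    have aNb : (b == a) = false by rewrite gt_eqF.
    have ff x : x \in `]a, b[ -> f x = dh x.
      by rewrite in_itv/= => /andP[ax xb]; rewrite /f gt_eqF// lt_eqF.
    have FF x : x \in `]a, b[ -> F x = h x.
      by rewrite in_itv/= => /andP[ax xb]; rewrite /F gt_eqF// lt_eqF.
    have nearab x : x \in `]a, b[ -> \forall y \near x, y \in `]a, b[.
      by move=> xab; exact: near_in_itvoo.
    have nra : \forall y \near a^'+, y \in `]a, b[.
      near=> y; rewrite in_itv/=; apply/andP; split; first by near: y; exact: nbhs_right_gt.
      by near: y; exact: nbhs_right_lt.
    have nlb : \forall y \near b^'-, y \in `]a, b[.
      near=> y; rewrite in_itv/=; apply/andP; split; last by near: y; exact: nbhs_left_lt.
      by near: y; exact: nbhs_left_gt.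
    transitivity (\int[lebesgue_measure]_(x in `[a, b]) f x).
      have mdh : measurable_fun `]a, b[ (fun x => (dh x)%:E).
        apply: (measurable_int lebesgue_measure).
        by apply: integrableS idh => //; exact: subset_itv_oo_cc.
      have mf : measurable_fun `]a, b[ (fun x => (f x)%:E).
        apply: eq_measurable_fun mdh => x /[!inE] /= xab.
        by rewrite /= ff.
      rewrite /Rintegral (integral_itv_bndoo true false mdh).
      rewrite (integral_itv_bndoo true false mf).
      by congr fine; apply: eq_integral => x /[!inE] /= xab; rewrite ff.
    rewrite /Rintegral (@continuous_FTC2 _ f F)//.
    - by rewrite /F aNb !eqxx.
    - apply/continuous_within_itvP => //; split.
      + move=> x xab; rewrite /continuous_at ff//; apply: cvg_trans (Cdh _ (ns _ xab)).
        by apply: near_eq_cvg; near=> y; rewrite ff//; near: y; exact: nearab.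
      + rewrite /f eqxx; apply: cvg_trans (dhr a); apply: near_eq_cvg.
        by near=> y; rewrite -[LHS]ff//; near: y.
      + rewrite /f aNb eqxx; apply: cvg_trans (dhl b); apply: near_eq_cvg.
        by near=> y; rewrite -[LHS]ff//; near: y.
    - split.
      + move=> x xab; have [dx _] := Dh _ (ns _ xab).
        apply: near_eq_derivable dx; near=> y.
        by rewrite FF//; near: y; exact: nearab.
      + rewrite /F eqxx; apply: cvg_trans (hrE a); apply: near_eq_cvg.
        by near=> y; rewrite -[LHS]FF//; near: y.
      + rewrite /F aNb eqxx; apply: cvg_trans (hlE b); apply: near_eq_cvg.
        by near=> y; rewrite -[LHS]FF//; near: y.
    - move=> x xab; rewrite ff//; have [_ <-] := Dh _ (ns _ xab); rewrite derive1E.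
      by apply: near_eq_derive; near=> y; rewrite FF//; near: y; exact: nearab.
  case: s' us' ss' => [|m s'] us' ss' /=; first by move=> _; exact: (IHn [::]).
  rewrite ltnS => sn; move: us' => /= /andP[ms' us'].
  have [mab|mab] := boolP (m \in `]a, b[); last first.
    rewrite big_cons (negbTE mab); apply: IHn => // x xab xs'; apply: ss' => //.
    rewrite inE negb_or xs' andbT; apply: contraNneq mab => <-//.
  have /andP[am mb] : a < m < b by move: mab; rewrite in_itv.
  have iam : lebesgue_measure.-integrable `[a, m] (EFin \o dh).
    by apply: integrableS idh => //; apply: subset_itvl; rewrite bnd_simp ltW.
  have imb : lebesgue_measure.-integrable `[m, b] (EFin \o dh).
    by apply: integrableS idh => //; apply: subset_itvr; rewrite bnd_simp ltW.
  have <- : \int[lebesgue_measure]_(x in `[a, m]) dh x +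
     \int[lebesgue_measure]_(x in `[m, b]) dh x =
     \int[lebesgue_measure]_(x in `[a, b]) dh x.
    rewrite -(Rintegral_itv_obnd_cbnd (r := m)); last first.
      by apply: integrableS imb => //; apply: subset_itvr; rewrite bnd_simp.
    by rewrite -(Rintegral_itvB idh) ?bnd_simp ?ltW// addrC subrK.
  rewrite (IHn s')//; last first.
    move=> x xam xs'; apply: ss' => //.
      by move: xam; rewrite !in_itv/= => /andP[-> /= /lt_trans->].
    rewrite inE negb_or xs' andbT lt_eqF//.
    by move: xam; rewrite !in_itv/= => /andP[].
  rewrite (IHn s')//; last first.
    move=> x xam xs'; apply: ss' => //.
      by move: xam; rewrite !in_itv/= => /andP[/(lt_trans am)-> ->].
    rewrite inE negb_or xs' andbT gt_eqF//.
    by move: xam; rewrite !in_itv/= => /andP[].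
  rewrite big_cons mab.
  suff -> : \sum_(x <- s' | x \in `]a, b[) (hr x - hl x) =
    \sum_(x <- s' | x \in `]a, m[) (hr x - hl x) +
    \sum_(x <- s' | x \in `]m, b[) (hr x - hl x) by ring.
  rewrite big_mkcond [X in X + _]big_mkcond [X in _ + X]big_mkcond -big_split/=.
  apply: eq_big_seq => x xs'; rewrite !in_itv/=.
  have [xm|mx|xm] := ltgtP x m.
  - by rewrite (lt_trans xm mb) ?andbT /= addr0.
  - by rewrite (lt_trans am mx) /= ?andbF add0r.
  - by move: ms'; rewrite -xm xs'.
move=> ab us idh; exact: (main (size s)).
Unshelve. all: by end_near.
Qed.

(** * Affine change of variable for the Lebesgue integral *)

Section affine_change_of_variable.
Context {R : realType}.
Notation mu := (@lebesgue_measure R).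
Variables (a c : R).
Hypothesis c0 : c != 0.
Let phi (y : measurableTypeR R) : measurableTypeR R := (y - a) / c.

Let mphi : measurable_fun setT phi.
Proof.
by apply: measurable_funM => //; exact: measurable_funB.
Qed.

Let k : {nonneg R} := (NngNum (normr_ge0 c^-1)).

(** By uniqueness of Lebesgue measure it is enough to compare on intervals []x, y]]. For negative
    [c] the preimage is closed on the left and open on the right, with the same length. *)
Let lebesgue_measure_affine (A : set R) : measurable A ->
  mu A = pushforward (mscale k mu) phi A.
Proof.
move=> mA; apply: lebesgue_measure_unique => //.
move=> _ [[x y]] _ <- /=; rewrite /pushforward /mscale/=.
have [xy|yx] := ltP x y; last first.
  by rewrite set_itv_ge ?bnd_simp -?leNgt// preimage_set0 !measure0 mule0.
rewrite lebesgue_measure_itv/= lte_fin xy.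
have [cgt0|clt0|] := ltgtP 0 c; last by move=> cE; move: c0; rewrite cE eqxx.
- rewrite (_ : _ @^-1` _ = `]a + c * x, a + c * y]%classic); last first.
    apply/seteqP; split => z /=; rewrite /phi !in_itv/= ltr_pdivlMr// ler_pdivrMr//
      => /andP[? ?]; apply/andP; split; lra.
  rewrite lebesgue_measure_itv/= lte_fin ltrD2l ltr_pM2l// xy.
  rewrite gtr0_norm ?invr_gt0// -[RHS]EFinM; congr EFin.
  by field.
- rewrite (_ : _ @^-1` _ = `[a + c * y, a + c * x[%classic); last first.
    apply/seteqP; split => z /=; rewrite /phi !in_itv/= ltr_ndivlMr// ler_ndivrMr//
      => /andP[? ?]; apply/andP; split; lra.
  rewrite lebesgue_measure_itv/= lte_fin ltrD2l ltr_nM2l// xy.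
  rewrite ltr0_norm ?invr_lt0// -[RHS]EFinM; congr EFin.
  by field.
Qed.

Let ge0_integral_affine (f : R -> \bar R) : measurable_fun setT f ->
  (forall x, 0 <= f x)%E ->
  (\int[mu]_y f ((y - a) / c)%R = `|c|%:E * \int[mu]_x f x)%E.
Proof.
move=> mf f0.
have -> : (\int[mu]_x f x = \int[pushforward (mscale k mu) phi]_x f x)%E.
  by apply: eq_measure_integral => A mA _ /=; exact: lebesgue_measure_affine.
rewrite ge0_integral_pushforward// preimage_setT ge0_integral_mscale//=; last first.
  exact: measurableT_comp.
by rewrite muleA -EFinM -normrM mulfV// normr1 mul1e.
Qed.

Lemma integrable_affine (f : R -> R) : mu.-integrable setT (EFin \o f) ->
  mu.-integrable setT (EFin \o (fun y => f ((y - a) / c))).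
Proof.
move=> /integrableP[mf fi]; apply/integrableP; split.
  exact: (measurableT_comp mf).
rewrite (ge0_integral_affine (f := fun x => `|(f x)%:E|%E))//.
  by rewrite lte_mul_pinfty.
exact: measurableT_comp.
Qed.

Lemma integral_affine (f : R -> R) : mu.-integrable setT (EFin \o f) ->
  \int[mu]_y f ((y - a) / c) = `|c| * \int[mu]_x f x.
Proof.
move=> fi; have mf := measurable_int _ fi.
have Ep := ge0_integral_affine (measurable_funepos mf) (funepos_ge0 _).
have En := ge0_integral_affine (measurable_funeneg mf) (funeneg_ge0 _).
rewrite -[`|c|]/(fine `|c|%:E) /Rintegral -fineM//; last exact: integrable_fin_num.
congr fine; rewrite integralE [in RHS]integralE muleBr//; last first.
  by rewrite fin_num_adde_defr// integrable_pos_fin_num.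
congr (_ - _)%E; [rewrite -[RHS]Ep|rewrite -[RHS]En]; apply: eq_integral => y _;
  by rewrite ?funeposE ?funenegE.
Qed.

End affine_change_of_variable.

(** Nothing is known about [f] near the ends beyond integrability, so the fundamental theorem
    applies on compact subintervals only: it makes [G - F] constant on []a, b[], where [G] is the
    integral from [a]. As [G] is continuous on [[a, b]] and [F] tends to 0 at both ends,
    [G b = G a = 0]. *)
Lemma integral_derive_oo0 (R : realType) (f F : R -> R) (a b : R) : a < b ->
  (@lebesgue_measure R).-integrable `[a, b] (EFin \o f) ->
  {in `]a, b[, continuous f} ->
  (forall x, x \in `]a, b[ -> is_derive x 1 F (f x)) ->
  F x @[x --> a^'+] --> 0 -> F x @[x --> b^'-] --> 0 ->
  \int[lebesgue_measure]_(x in `]a, b[) f x = 0.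
Proof.
move=> ab fi cf dF Fa Fb.
pose G x := \int[lebesgue_measure]_(t in `[a, x]) f t.
have /(continuous_within_itvP _ ab)[_ Ga Gb] : {within `[a, b], continuous G}.
  exact: (parameterized_integral_continuous (ltW ab) fi).
have GF x y : x \in `]a, b[ -> y \in `]a, b[ -> x < y -> G y - F y = G x - F x.
  rewrite !in_itv/= => /andP[ax xb] /andP[ay yb] xy.
  have fiy : lebesgue_measure.-integrable `[a, y] (EFin \o f).
    by apply: integrableS fi => //; apply: subset_itvl; rewrite bnd_simp ltW.
  suff : G y - G x = F y - F x by move=> /eqP; rewrite subr_eq => /eqP ->; ring.
  rewrite /G Rintegral_itvB ?bnd_simp ?ltW// Rintegral_itv_obnd_cbnd; last first.
    by apply: integrableS fiy => //; apply: subset_itvr; rewrite bnd_simp ltW.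
  have xyab z : z \in `[x, y] -> z \in `]a, b[.
    by rewrite !in_itv/= => /andP[/(lt_le_trans ax)-> /le_lt_trans->].
  have dF' z : z \in `[x, y] -> derivable F z 1 by move=> /xyab/dF[].
  have cF z : z \in `[x, y] -> {for z, continuous F}.
    by move=> /dF'/derivable1_diffP/differentiable_continuous.
  rewrite /Rintegral (@continuous_FTC2 _ f F)//.
  - apply: continuous_in_subspaceT => z; rewrite inE/= => /xyab; exact: cf.
  - split.
    + by move=> z /subset_itv_oo_cc; exact: dF'.
    + apply: cvg_at_right_filter; apply: cF; rewrite in_itv/= lexx ltW//.
    + apply: cvg_at_left_filter; apply: cF; rewrite in_itv/= lexx ltW//.
  - by move=> z /subset_itv_oo_cc/xyab/dF[_ <-]; rewrite derive1E.
pose m := (a + b) / 2.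
have mab : m \in `]a, b[ by rewrite in_itv/= /m; apply/andP; split; lra.
have Ga' : G a = G m - F m.
  have : (G x - F x) @[x --> a^'+] --> G a - 0 by exact: cvgB.
  rewrite subr0 => /cvg_lim <- //; apply: lim_near_cst => //.
  near=> x; symmetry; apply: GF => //.
    rewrite in_itv/=; apply/andP; split; near: x; [exact: nbhs_right_gt|exact: nbhs_right_lt].
  near: x; apply: nbhs_right_lt; by move: mab; rewrite in_itv/= => /andP[].
have Gb' : G b = G m - F m.
  have : (G x - F x) @[x --> b^'-] --> G b - 0 by exact: cvgB.
  rewrite subr0 => /cvg_lim <- //; apply: lim_near_cst => //.
  near=> x; apply: GF => //.
    rewrite in_itv/=; apply/andP; split; near: x; [exact: nbhs_left_gt|exact: nbhs_left_lt].
  near: x; apply: nbhs_left_gt; by move: mab; rewrite in_itv/= => /andP[].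
transitivity (G b).
  rewrite /G /Rintegral (@integral_itv_bndoo _ a b _ true false)//.
  apply: (measurable_int lebesgue_measure).
  by apply: integrableS fi => //; exact: subset_itv_oo_cc.
by rewrite Gb' -Ga' /G set_itv1 Rintegral_set1.
Unshelve. all: by end_near.
Qed.

(** * Slicing by horizontal lines *)

Lemma integral_sum_seq (R : realType) (I : eqType) (es : seq I) (f : I -> R -> R) :
  (forall e, e \in es -> (@lebesgue_measure R).-integrable setT (EFin \o f e)) ->
  (@lebesgue_measure R).-integrable setT (EFin \o (fun x => \sum_(e <- es) f e x)) /\
  \int[@lebesgue_measure R]_x (\sum_(e <- es) f e x)
    = \sum_(e <- es) \int[@lebesgue_measure R]_x f e x.
Proof.
elim: es => [|e es IHes] fi.
  rewrite (_ : (fun x => \sum_(e <- [::]) f e x) = cst 0); last first.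
    by apply/funext => x; rewrite big_nil.
  split; first exact: integrable0.
  by rewrite big_nil /Rintegral integral0.
rewrite (_ : (fun x => \sum_(e <- e :: es) f e x) =
  (fun x => f e x + \sum_(e <- es) f e x)); last first.
  by apply/funext => x; rewrite big_cons.
have [|IHi IHe] := IHes; first by move=> i ies; apply: fi; rewrite inE ies orbT.
have fe : lebesgue_measure.-integrable setT (EFin \o f e).
  by apply: fi; rewrite inE eqxx.
split; first exact: (integrableD _ fe IHi).
by rewrite RintegralD// IHe big_cons.
Qed.

(** A horizontal line at a generic height meets each segment at most once, and transversally. Along
    it the integral of [D] is minus the sum of the jumps of [g] at these crossings. Integrating over
    the height and substituting [s = (y - (a e).2) / ((b e).2 - (a e).2)] turns each crossing into
    an integral over the edge parameter, with the height of the edge as Jacobian. *)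
Lemma integral_slices (R : realType) (I : eqType) (es : seq I)
    (a b : I -> R * R) (g D : R -> R -> R) (jmp : I -> R -> R) (M : R) :
  let gam e s := ((1 - s) *: a e + s *: b e : R * R) in
  uniq es ->
  (forall x y, (forall e s, e \in es -> s \in `[0, 1] -> gam e s <> (x, y)) ->
    is_derive x 1 (g ^~ y) (D x y) /\ {for x, continuous (D ^~ y)}) ->
  (forall e e' s s', e \in es -> e' \in es -> s \in `]0, 1[ -> s' \in `]0, 1[ ->
    gam e s = gam e' s' -> e = e') ->
  (forall e s, e \in es -> s \in `]0, 1[ -> (a e).2 != (b e).2 ->
    let p := gam e s in
    [/\ cvg (D x p.2 @[x --> p.1^'+]), cvg (D x p.2 @[x --> p.1^'-]),
        cvg (g x p.2 @[x --> p.1^'+]), cvg (g x p.2 @[x --> p.1^'-])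
      & jmp e s = lim (g x p.2 @[x --> p.1^'+]) - lim (g x p.2 @[x --> p.1^'-])]) ->
  0 < M -> (forall x y, M <= `|x| -> g x y = 0 /\ D x y = 0) ->
  (forall e, e \in es ->
    (@lebesgue_measure R).-integrable setT (EFin \o (jmp e \_ `]0, 1[))) ->
  (forall y, (@lebesgue_measure R).-integrable setT (EFin \o (D ^~ y))) ->
  measurable_fun setT (fun y => \int[@lebesgue_measure R]_x D x y) ->
  \int[@lebesgue_measure R]_y (\int[@lebesgue_measure R]_x D x y) =
  - \sum_(e <- es) `|(b e).2 - (a e).2| *
       \int[@lebesgue_measure R]_(s in `]0, 1[) jmp e s.
Proof.
move=> gam us Dg inj lims M0 gD0 ijmp iD mD.
pose c e := (b e).2 - (a e).2.
pose se e y := (y - (a e).2) / c e.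
(* For a horizontal edge [c e = 0], and since the inverse of 0 is 0, [se e y = 0] falls outside []0,
   1[]: such an edge contributes nothing, on both sides of the formula. *)
pose je e y := (jmp e \_ `]0, 1[) (se e y).
have [|ije Sje] := @integral_sum_seq _ _ es je.
  move=> e ees; have [c0|c0] := eqVneq (c e) 0; last exact: integrable_affine (ijmp e ees).
  apply: eq_integrable (integrable0 _ _) => // y _.
  by rewrite /= /je /se c0 invr0 mulr0 patchE ifF//; apply/negP; rewrite inE/= in_itv/= ltxx.
have -> : \sum_(e <- es) `|(b e).2 - (a e).2| *
       \int[@lebesgue_measure R]_(s in `]0, 1[) jmp e s =
    \sum_(e <- es) \int[lebesgue_measure]_y je e y.
  apply: eq_big_seq => e ees; rewrite -/(c e).
  have [c0|c0] := eqVneq (c e) 0.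
    rewrite c0 normr0 mul0r (_ : je e = cst 0) ?/Rintegral ?integral0//.
    apply/funext => y; rewrite /je /se c0 invr0 mulr0 patchE ifF//.
    by apply/negP; rewrite inE/= in_itv/= ltxx.
  by rewrite Rintegral_mkcond -(integral_affine (a e).2 c0 (ijmp e ees)).
rewrite -Sje /Rintegral -fineN; congr fine.
rewrite -[LHS]/(\int[lebesgue_measure]_x (\int[lebesgue_measure]_x0 D x0 x)%:E)%E.
have mje : measurable_fun setT (fun x => (\sum_(e <- es) je e x)%:E).
  exact: (measurable_int _ ije).
rewrite -integralN; last first.
  rewrite fin_num_adde_defr//; exact: integrable_pos_fin_num.
apply: ae_eq_integral => //.
- exact/measurable_EFinP.
- exact: measurableT_comp.
(* The heights of the endpoints, a null set. A line at any other height passes through no endpoint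
   and contains no horizontal edge. *)
pose B := [set` [seq (a e).2 | e <- es] ++ [seq (b e).2 | e <- es]].
exists B; split.
- by apply/countable_measurable/finite_set_countable/finite_seq.
- by apply/countable_lebesgue_measure0/finite_set_countable/finite_seq.
apply: subsetCl => y yB _ /=.
have [yNa yNb] : (forall e, e \in es -> y != (a e).2) /\ (forall e, e \in es -> y != (b e).2).
  split => e ees; apply/eqP => ye; apply: yB; rewrite /B/= mem_cat; apply/orP.
  - by left; apply/mapP; exists e.
  - by right; apply/mapP; exists e.
rewrite -[RHS]EFinN; congr EFin.
pose xe e := (1 - se e y) * (a e).1 + se e y * (b e).1.
have gamE e : c e != 0 -> gam e (se e y) = (xe e, y).
  move=> c0; congr pair; rewrite -[LHS]/((1 - se e y) * (a e).2 + se e y * (b e).2) /se.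
  by rewrite /c in c0 *; field.
have cN0 e : e \in es -> se e y \in `]0, 1[ -> c e != 0.
  move=> ees; apply: contraTneq => c0.
  by rewrite /se c0 invr0 mulr0 in_itv/= ltxx.
(* The abscissas of the crossings at height [y]. They are pairwise distinct because different edges
   have disjoint relative interiors. *)
pose S := [seq xe e | e <- es & se e y \in `]0, 1[].
have uS : uniq S.
  rewrite map_inj_in_uniq ?filter_uniq// => e e'.
  rewrite !mem_filter => /andP[se1 ees] /andP[se2 ees'] xee'.
  by apply: (inj _ _ (se e y) (se e' y)) => //; rewrite !gamE ?cN0// xee'.
have offS x : x \notin S ->
    is_derive x 1 (g ^~ y) (D x y) /\ {for x, continuous (D ^~ y)}.
  move=> xS; apply: Dg => e s ees s01 /(congr1 (fun p => (p.1, p.2))) [] gx gy.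
  have {}gx : (1 - s) * (a e).1 + s * (b e).1 = x by [].
  have {}gy : (1 - s) * (a e).2 + s * (b e).2 = y by [].
  have cE : s * c e = y - (a e).2 by rewrite -gy /c; ring.
  have c0 : c e != 0.
    apply: contraNneq (yNa e ees) => c0.
    by move/eqP: cE; rewrite c0 mulr0 eq_sym subr_eq0.
  have sE : s = se e y by rewrite /se -cE mulfK.
  have s0 : s != 0.
    by apply: contraNneq (yNa e ees) => s0; move: gy; rewrite s0 subr0 mul1r mul0r addr0 => ->.
  have s1 : s != 1.
    by apply: contraNneq (yNb e ees) => s1; move: gy; rewrite s1 subrr mul1r mul0r add0r => ->.
  move/negP: xS; apply; apply/mapP; exists e; last by rewrite -gx /xe -sE.
  rewrite mem_filter ees andbT -sE; move: s01; rewrite !in_itv/= => /andP[ge0 le1].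
  by rewrite !lt_neqAle eq_sym s0 s1 ge0 le1.
have onS x : x \in S -> exists e, [/\ e \in es, se e y \in `]0, 1[,
    gam e (se e y) = (x, y) & (a e).2 != (b e).2].
  move=> /mapP[e]; rewrite mem_filter => /andP[sey ees] ->; exists e.
  have c0 := cN0 _ ees sey.
  by split => //; [exact: gamE|rewrite eq_sym -subr_eq0].
pose hr x := lim (g z y @[z --> x^'+]).
pose hl x := lim (g z y @[z --> x^'-]).
have cvgs x : [/\ cvg (D z y @[z --> x^'+]), cvg (D z y @[z --> x^'-]),
    cvg (g z y @[z --> x^'+]) & cvg (g z y @[z --> x^'-])].
  have [xS|xS] := boolP (x \in S).
    have [e [ees s01 ge ab]] := onS x xS.
    by have := lims e _ ees s01 ab; rewrite ge/= => -[].
  have [[dg _] cD] := offS x xS.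
  have cg : {for x, continuous (g ^~ y)}.
    by apply: differentiable_continuous; apply/derivable1_diffP.
  split; apply/cvg_ex; eexists; first [exact: (cvg_at_right_filter cD)
   | exact: (cvg_at_left_filter cD) | exact: (cvg_at_right_filter cg)
   | exact: (cvg_at_left_filter cg)].
(* The margin 1 beyond [M] makes [g] vanish on a whole neighbourhood of both ends, so that its
   one-sided limits there are 0. *)
have M1 : - (M + 1) < M + 1 by lra.
have iDM : lebesgue_measure.-integrable `[- (M + 1), M + 1] (EFin \o (D ^~ y)).
  exact: integrableS (iD y).
have big0 x : M < `|x| -> hr x = 0 /\ hl x = 0.
  move=> Mx; have near0 : \forall z \near x, g z y = 0.
    have : `|z| @[z --> x] --> `|x| by exact: norm_continuous.
    move=> /cvgr_gt/(_ M Mx); apply: filterS => z Mz.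
    by have [] := gD0 z y (ltW Mz).
  split; apply: lim_near_cst => //.
  - by move: near0; exact: cvg_within.
  - by move: near0; exact: cvg_within.
transitivity (\int[lebesgue_measure]_(x in `[- (M + 1), M + 1]) D x y).
  rewrite [RHS]Rintegral_mkcond; apply: eq_Rintegral => x _; rewrite patchE.
  case: ifPn => //; rewrite notin_setE/= in_itv/= -ler_norml => /negP; rewrite -ltNge => Mx.
  by have [] := gD0 x y; first by rewrite (le_trans _ (ltW Mx))// lerDl.
have hrE x : g z y @[z --> x^'+] --> hr x by have [] := cvgs x.
have hlE x : g z y @[z --> x^'-] --> hl x by have [] := cvgs x.
have Dr x : cvg (D z y @[z --> x^'+]) by have [] := cvgs x.
have Dl x : cvg (D z y @[z --> x^'-]) by have [] := cvgs x.
rewrite [LHS](integral_piecewise_derive M1 uS (fun x xS => (offS x xS).1)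
  (fun x xS => (offS x xS).2) Dr Dl hrE hlE iDM).
have normM : M < `|M + 1| by rewrite ger0_norm; lra.
rewrite (big0 (M + 1) normM).2 (big0 (- (M + 1)) _).1 ?normrN// subr0 sub0r; congr (- _).
rewrite big_mkcond/= big_map big_filter big_mkcond/=.
apply: eq_big_seq => e ees; rewrite /je patchE mem_setE.
case: ifPn => // s01.
have c0 := cN0 _ ees s01.
have [|_ _ _ _ ->] := lims e _ ees s01; first by rewrite eq_sym -subr_eq0.
rewrite gamE//=; case: ifPn => // xM.
suff Mx : M < `|xe e| by have [] := big0 _ Mx; rewrite /hr /hl => -> ->; rewrite subr0.
rewrite ltNge; apply: contra xM; rewrite ler_norml in_itv/= => /andP[? ?].
apply/andP; split; lra.
Qed.

(** * Segments and the geometry of the mesh *)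

Section plane_calculus.
Context {R : realType}.
Implicit Types (f : pt R -> R) (p v w x y : pt R).

Lemma near_boxP p (P : set (pt R)) : (\forall y \near p, P y) <->
  exists2 d : R, 0 < d &
    forall y, `|y.1 - p.1| < d -> `|y.2 - p.2| < d -> P y.
Proof.
split=> [/nbhs_ballP[d d0 dP]|[d d0 dP]].
  exists d => // y y1 y2; apply: dP; split => /=; rewrite /ball/= distrC//.
apply/nbhs_ballP; exists d => // y [y1 y2].
by apply: dP; rewrite distrC.
Qed.

Lemma is_derive_line f p w s d :
  is_derive (p + s *: w) w f d <-> is_derive s (1 : R) (fun t => f (p + t *: w)) d.
Proof.
have E : (fun h : R => h^-1 *: ((f \o shift (p + s *: w)) (h *: w) - f (p + s *: w))) =
  (fun h : R => h^-1 *: (((fun t => f (p + t *: w)) \o shift s) (h *: 1) -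
                        (fun t => f (p + t *: w)) s)).
  apply/funext => h /=; rewrite -[h *: 1]/(h * 1) mulr1; congr (_ *: (f _ - _)).
  by rewrite scalerDl addrCA.
by split => -[]; rewrite /derivable /derive ?E => H1 H2; apply: DeriveDef;
  rewrite /derivable /derive ?E// -?E.
Qed.

Lemma mean_value_line f (df : pt R -> R) p w (r : R) :
  (forall s, `|s| <= `|r| -> is_derive (p + s *: w) w f (df (p + s *: w))) ->
  exists2 s, `|s| <= `|r| & f (p + r *: w) - f p = r * df (p + s *: w).
Proof.
move=> H; pose h s := f (p + s *: w); pose dh s := df (p + s *: w).
have dH s : `|s| <= `|r| -> is_derive s (1 : R) h (dh s) by move=> /H/is_derive_line.
have cH s : `|s| <= `|r| -> {for s, continuous h}.
  by move=> /dH[+ _] => /derivable1_diffP/differentiable_continuous.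
have h0 : h 0 = f p by rewrite /h scale0r addr0.
have [r0|r0] := leP 0 r.
- have I s : s \in `[0, r] -> `|s| <= `|r|.
    by rewrite in_itv/= => /andP[s0 sr]; rewrite !ger0_norm.
  have [||c /I cr] := @MVT_segment R h dh 0 r r0.
  + by move=> x /subset_itv_oo_cc/I; exact: dH.
  + by apply: continuous_in_subspaceT => x; rewrite inE/= => /I; exact: cH.
  by rewrite h0 subr0 => E; exists c => //; rewrite mulrC.
- have I s : s \in `[r, 0] -> `|s| <= `|r|.
    by rewrite in_itv/= => /andP[s0 sr]; rewrite !ler0_norm ?lerN2// ltW.
  have [||c /I cr] := @MVT_segment R h dh r 0 (ltW r0).
  + by move=> x /subset_itv_oo_cc/I; exact: dH.
  + by apply: continuous_in_subspaceT => x; rewrite inE/= => /I; exact: cH.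
  rewrite h0 sub0r mulrN => E; exists c => //.
  by apply: oppr_inj; rewrite opprB E mulrC.
Qed.

Lemma is_derive1P (h : R -> R) (s l : R) :
  (forall e, 0 < e -> \forall t \near s, `|h t - h s - (t - s) * l| <= e * `|t - s|) ->
  is_derive s (1 : R) h l.
Proof.
move=> H.
have C : (fun t : R => t^-1 *: ((h \o shift s) (t *: 1) - h s)) @ 0^' --> l.
  apply/cvgrPdist_le => e e0; have := H e e0.
  rewrite (near_shift 0) /= => Hn.
  have {}Hn : \forall x \near 0^', `|(h \o shift s) (x *: (1 : R)) - h s - x * l| <= e * `|x|.
    apply: cvg_within; apply: filterS Hn => x /=.
    by rewrite subr0 addrK -[x *: 1]/(x * 1) mulr1.
  near=> x; have x0 : x != 0 by near: x; exact: nbhs_dnbhs_neq.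
  rewrite -[l](mulKf x0) -[_ *: _]/(_ * _) -mulrBr normrM normfV.
  by rewrite ler_pdivrMl ?normr_gt0// distrC [leRHS]mulrC; near: x.
by apply: DeriveDef; [apply/cvg_ex; exists l|exact: cvg_lim].
Unshelve. all: by end_near.
Qed.

(** The increment from [x] to [x + h v] is split into a vertical and a horizontal move. The mean
    value theorem on each gives partial derivatives at nearby points, which continuity compares with
    those at [x]. The tolerance is [e / m] because the two errors are weighted by [|v.1|] and
    [|v.2|]; the [+ 1] in [m] covers [v = 0]. *)
Lemma is_derive_direction f x v :
  (\forall y \near x, forall i, derivable f y (basis_vec R i)) ->
  (forall i, {for x, continuous (pderiv i f)}) ->
  is_derive x v f (v.1 * pderiv 0 f x + v.2 * pderiv 1 f x).
Proof.
move=> df cf; rewrite -[x]addr0 -(scale0r v); apply/is_derive_line/is_derive1P.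
rewrite scale0r addr0 => e e0.
pose m := `|v.1| + `|v.2| + 1.
have m0 : 0 < m by rewrite ltr_wpDl// addr_ge0.
have e'0 : 0 < e / m by rewrite divr_gt0.
have /near_boxP[d d0 dP] : \forall y \near x,
    [/\ forall i, derivable f y (basis_vec R i),
     `|pderiv 0 f x - pderiv 0 f y| <= e / m & `|pderiv 1 f x - pderiv 1 f y| <= e / m].
  have ct i : \forall y \near x, `|pderiv i f x - pderiv i f y| <= e / m.
    by move/cvgrPdist_le : (cf i) => /(_ _ e'0).
  by apply: filterS3 df (ct 0) (ct 1) => y; split.
have dm : 0 < d / m by rewrite divr_gt0.
have bs0 (z : pt R) (s : R) : z + s *: basis_vec R 0 = (z.1 + s, z.2) :> pt R.
  by rewrite [LHS]surjective_pairing/=; congr pair;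
    rewrite -[s *: _]/(s * _) /= ?mulr1 ?mulr0 ?addr0.
have bs1 (z : pt R) (s : R) : z + s *: basis_vec R 1 = (z.1, z.2 + s) :> pt R.
  by rewrite [LHS]surjective_pairing/=; congr pair;
    rewrite -[s *: _]/(s * _) /= ?mulr1 ?mulr0 ?addr0.
near=> h.
have hd : `|h| * m < d.
  rewrite -ltr_pdivlMr//; near: h; exact: nbhs0_lt.
have h1 : `|h * v.1| < d.
  apply: le_lt_trans hd; rewrite normrM ler_wpM2l// /m; have := normr_ge0 v.2; lra.
have h2 : `|h * v.2| < d.
  apply: le_lt_trans hd; rewrite normrM ler_wpM2l// /m; have := normr_ge0 v.1; lra.
have box s t : `|s| < d -> `|t| < d -> [/\ forall i, derivable f (x.1 + s, x.2 + t) (basis_vec R i),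
     `|pderiv 0 f x - pderiv 0 f (x.1 + s, x.2 + t)| <= e / m &
     `|pderiv 1 f x - pderiv 1 f (x.1 + s, x.2 + t)| <= e / m].
  by move=> ? ?; apply: dP; rewrite /= addrAC subrr add0r.
have [|s1 s1h E1] := @mean_value_line f (pderiv 0 f) (x.1, x.2 + h * v.2) (basis_vec R 0) (h * v.1).
  move=> s sh; rewrite bs0; have [|/(_ 0) D _ _] := box s (h * v.2) _ h2.
    exact: le_lt_trans h1.
  exact: derivableP.
have [|s2 s2h E2] := @mean_value_line f (pderiv 1 f) (x.1, x.2) (basis_vec R 1) (h * v.2).
  move=> s sh; rewrite bs1/=; have [||/(_ 1) D _ _] := box 0 s; first by rewrite normr0.
    exact: le_lt_trans h2.
  by rewrite addr0 in D; exact: derivableP.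
rewrite !bs0/= in E1; rewrite !bs1/= in E2.
have -> : f (x + h *: v) = f (x.1 + h * v.1, x.2 + h * v.2) by [].
have -> : f (x.1 + h * v.1, x.2 + h * v.2) - f x =
   h * v.1 * pderiv 0 f (x.1 + s1, x.2 + h * v.2) + h * v.2 * pderiv 1 f (x.1, x.2 + s2).
  by rewrite -E2 -E1 -surjective_pairing; ring.
rewrite subr0.
have [_ P1 _] : [/\ forall i, derivable f (x.1 + s1, x.2 + h * v.2) (basis_vec R i),
     `|pderiv 0 f x - pderiv 0 f (x.1 + s1, x.2 + h * v.2)| <= e / m &
     `|pderiv 1 f x - pderiv 1 f (x.1 + s1, x.2 + h * v.2)| <= e / m].
  by apply: box => //; exact: le_lt_trans h1.
have [_ _ P2] : [/\ forall i, derivable f (x.1 + 0, x.2 + s2) (basis_vec R i),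
     `|pderiv 0 f x - pderiv 0 f (x.1 + 0, x.2 + s2)| <= e / m &
     `|pderiv 1 f x - pderiv 1 f (x.1 + 0, x.2 + s2)| <= e / m].
  by apply: box; [rewrite normr0|exact: le_lt_trans h2].
rewrite addr0 in P2.
rewrite (_ : _ - _ = - (h * v.1 * (pderiv 0 f x - pderiv 0 f (x.1 + s1, x.2 + h * v.2)) +
  h * v.2 * (pderiv 1 f x - pderiv 1 f (x.1, x.2 + s2)))); last by ring.
rewrite normrN; apply: le_trans (ler_normD _ _) _; rewrite !normrM.
apply: (@le_trans _ _ (`|h| * `|v.1| * (e / m) + `|h| * `|v.2| * (e / m))).
  by apply: lerD; apply: ler_wpM2l => //; exact: mulr_ge0.
rewrite (_ : _ + _ = e * `|h| * ((`|v.1| + `|v.2|) / m)); last by ring.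
apply: ler_piMr; first by rewrite mulr_ge0// ltW.
by rewrite ler_pdivrMr// mul1r lerDl.
Unshelve. all: by end_near.
Qed.

End plane_calculus.

(** * Segments, normals and half-plane filters *)

Section segments.
Context {R : realType}.
Implicit Types (a b p q n v w x y : pt R) (e : set (pt R)).

Lemma dotE u v : dot u v = u.1 * v.1 + u.2 * v.2 :> R.
Proof. by rewrite /dot !big_ord_recl big_ord0 addr0. Qed.

Lemma dotZr n (t : R) w : dot n (t *: w) = t * dot n w.
Proof.
by rewrite !dotE -[LHS]/(n.1 * (t * w.1) + n.2 * (t * w.2)); ring.
Qed.

Lemma dotDr n v w : dot n (v + w) = dot n v + dot n w.
Proof.
by rewrite !dotE -[LHS]/(n.1 * (v.1 + w.1) + n.2 * (v.2 + w.2)); ring.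
Qed.

Lemma dotNl n w : dot (- n) w = - dot n w.
Proof. by rewrite !dotE -[LHS]/(- n.1 * w.1 + - n.2 * w.2); ring. Qed.

Lemma dotNr n w : dot n (- w) = - dot n w.
Proof. by rewrite -scaleN1r dotZr mulN1r. Qed.

Lemma continuous_affine_pt p w : continuous (fun s : R => p + s *: w).
Proof. by move=> s; apply: cvgD; [exact: cvg_cst|apply: cvgZr_tmp; exact: cvg_id]. Qed.

Lemma segment_param a b (s : R) : (1 - s) *: a + s *: b = a + s *: (b - a).
Proof. by rewrite scalerBl scale1r scalerBr addrAC -!addrA. Qed.

Lemma segmentE a b : segment a b = (fun s : R => a + s *: (b - a)) @` `[0, 1].
Proof.
by apply/seteqP; split => _ [s s01 <-]; exists s => //; rewrite segment_param.
Qed.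

Lemma compact_segment_pt a b : compact (segment a b).
Proof.
rewrite segmentE; apply: continuous_compact; last exact: segment_compact.
exact/continuous_subspaceT/continuous_affine_pt.
Qed.

Lemma closed_segment_pt a b : closed (segment a b).
Proof. by apply: compact_closed; [exact: norm_hausdorff|exact: compact_segment_pt]. Qed.

Lemma connected_segment_pt a b : connected (segment a b).
Proof.
rewrite segmentE; apply: connected_continuous_connected; first exact: segment_connected.
exact/continuous_subspaceT/continuous_affine_pt.
Qed.

(** [endpoints] quantifies over all ways to write the set as a segment, so the endpoints must be
    recovered from the set alone. If [c, d] is another pair, then expressing [c] through [a, b] and
    these through [c, d] gives [((1 - s) t + s u) (d - c) = 0] with nonnegative terms; both products
    vanish, and each case gives [c = a], [c = b] or a contradiction. *)
Lemma endpoints_segment a b : a != b -> endpoints (segment a b) = [set a; b].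
Proof.
have segl x y : segment x y x.
  by exists 0; rewrite /= ?in_itv/= ?lexx ?ler01// subr0 scale1r scale0r addr0.
have segr x y : segment x y y.
  by exists 1; rewrite /= ?in_itv/= ?lexx ?ler01// subrr scale1r scale0r add0r.
move=> ab; apply/seteqP; split => [c [d [cd segE]]|_ [->|->]]; last 2 first.
- by exists b.
- exists a; split; first by rewrite eq_sym.
  apply/seteqP; split => _ [s s01 <-]; exists (1 - s); rewrite ?subKr 1?addrC//.
  + by move: s01; rewrite /= !in_itv/= => /andP[? ?]; apply/andP; split; lra.
  + by move: s01; rewrite /= !in_itv/= => /andP[? ?]; apply/andP; split; lra.
have /= [s] : segment a b c by rewrite segE.
have /= [t] : segment c d a by rewrite -segE.
have /= [u] : segment c d b by rewrite -segE.
rewrite !segment_param !in_itv/= => /andP[u0 u1] bE /andP[t0 t1] aE /andP[s0 s1] cE.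
have [d0 d0'] : (1 - s) * t * (d.1 - c.1) + s * u * (d.1 - c.1) = 0 /\
     (1 - s) * t * (d.2 - c.2) + s * u * (d.2 - c.2) = 0.
  split; [apply: (addrI c.1)|apply: (addrI c.2)]; rewrite addr0.
  - have c1 : a.1 + s * (b.1 - a.1) = c.1 := congr1 fst cE.
    have a1 : c.1 + t * (d.1 - c.1) = a.1 := congr1 fst aE.
    have b1 : c.1 + u * (d.1 - c.1) = b.1 := congr1 fst bE.
    by rewrite -[RHS]c1 -a1 -b1; ring.
  - have c2 : a.2 + s * (b.2 - a.2) = c.2 := congr1 snd cE.
    have a2 : c.2 + t * (d.2 - c.2) = a.2 := congr1 snd aE.
    have b2 : c.2 + u * (d.2 - c.2) = b.2 := congr1 snd bE.
    by rewrite -[RHS]c2 -a2 -b2; ring.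
have k0 : (1 - s) * t + s * u = 0.
  apply/eqP; apply: contraT => k0; move: cd; rewrite -[c == d]negbK => /negP[].
  have [/eqP] : d.1 - c.1 = 0 /\ d.2 - c.2 = 0.
    by split; apply: (mulfI k0); rewrite mulr0 mulrDl.
  rewrite subr_eq0 => /eqP d1 /eqP; rewrite subr_eq0 => /eqP d2.
  by rewrite negbK [c]surjective_pairing [d]surjective_pairing d1 d2.
have [/eqP p0 /eqP q0] : (1 - s) * t = 0 /\ s * u = 0.
  have P := mulr_ge0 s0 u0.
  have Q : 0 <= (1 - s) * t by rewrite mulr_ge0 ?subr_ge0.
  by split; lra.
move: p0 q0; rewrite !mulf_eq0 subr_eq0 => /orP[/eqP s_1|/eqP t_0] /orP[/eqP s_0|/eqP u_0].
- by move: s_1; rewrite s_0 => /eqP; rewrite oner_eq0.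
- by right; move: cE; rewrite -s_1 scale1r subrKC.
- by left; move: cE; rewrite s_0 scale0r addr0.
- by move: ab; rewrite -aE -bE t_0 u_0 eqxx.
Qed.

Lemma segment_interior_point a b (s : R) : a != b -> s \in `]0, 1[ ->
  let p := (1 - s) *: a + s *: b in segment a b p /\ ~ endpoints (segment a b) p.
Proof.
move=> ab s01 p; split; first by exists s => //; exact: subset_itv_oo_cc s01.
have [s0 s1] : 0 < s /\ s < 1 by move: s01; rewrite in_itv/= => /andP[].
rewrite endpoints_segment// /p segment_param => -[/eqP|/eqP].
- rewrite -subr_eq0 addrC addKr scaler_eq0 gt_eqF//= subr_eq0 eq_sym.
  exact/negP.
- rewrite -subr_eq0 addrAC -opprB -scaleN1r -scalerDl scaler_eq0 addrC subr_eq0.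
  by rewrite lt_eqF//= subr_eq0 eq_sym; exact/negP.
Qed.

Lemma unit_normalN e n : unit_normal e n -> unit_normal e (- n).
Proof.
move=> [n1 ne]; split; first by rewrite dotNl dotNr opprK.
by move=> x y ex ey; rewrite dotNl ne// oppr0.
Qed.

Lemma unit_normal_segment a b n : unit_normal (segment a b) n -> dot n (b - a) = 0.
Proof.
move=> [_ ne]; apply: ne; first by exists 1; rewrite /= ?in_itv/= ?lexx ?ler01//
  subrr scale0r scale1r add0r.
by exists 0; rewrite /= ?in_itv/= ?lexx ?ler01// subr0 scale0r scale1r addr0.
Qed.

Lemma orthogonal_tangent n w : dot n n = 1 -> dot n w = 0 ->
  let c := dot (tangent n) w in w.1 = - c * n.2 /\ w.2 = c * n.1.
Proof.
rewrite !dotE /tangent /=.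
move: n.1 n.2 w.1 w.2 => n_1 n_2 u v nn nuv; split.
- have -> : - (- n_2 * u + n_1 * v) * n_2 =
    (n_1 * n_1 + n_2 * n_2) * u - n_1 * (n_1 * u + n_2 * v) by ring.
  by rewrite nn nuv mul1r mulr0 subr0.
- have -> : (- n_2 * u + n_1 * v) * n_1 =
    (n_1 * n_1 + n_2 * n_2) * v - n_2 * (n_1 * u + n_2 * v) by ring.
  by rewrite nn nuv mul1r mulr0 subr0.
Qed.

(** Approach to [p] from the open half-plane towards which [n] points. It names one side of an edge
    without naming the element found there. *)
Definition half_nbhs n p : set_system (pt R) :=
  within [set y | 0 < dot n (y - p)] (nbhs p).

Global Instance half_nbhs_filter n p : Filter (half_nbhs n p).
Proof. exact: within_filter. Qed.

Lemma half_nbhs_ray n p w : 0 < dot n w ->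
  (p + t *: w) @[t --> (0 : R)^'+] --> half_nbhs n p.
Proof.
move=> nw P; rewrite /half_nbhs /within /= => nP.
have : (p + t *: w) @[t --> (0 : R)^'+] --> p.
  rewrite -[X in _ --> X]addr0 -(scale0r w).
  exact/cvg_at_right_filter/continuous_affine_pt.
move=> /(_ _ nP) H; have {}H : \forall t \near (0 : R)^'+,
  0 < dot n (p + t *: w - p) -> P (p + t *: w) by [].
suff : \forall t \near (0 : R)^'+, P (p + t *: w) by [].
near=> t; have t0 : 0 < t by near: t; exact: nbhs_right_gt.
have : 0 < dot n (p + t *: w - p) -> P (p + t *: w) by near: t; exact: H.
apply; rewrite addrC addKr.
by rewrite dotZr mulr_gt0.
Unshelve. all: by end_near.
Qed.

Lemma half_nbhs_proper n p : dot n n = 1 -> ProperFilter (half_nbhs n p).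
Proof.
move=> n1; apply: Build_ProperFilter_ex => P nP.
have n0 : 0 < dot n n by rewrite n1.
have /filter_ex[t Pt] := half_nbhs_ray n0 nP.
by exists t.
Qed.

End segments.

(** * Position of the elements around an edge *)

Section mesh_geometry.
Context {R : realType} (Omega : set (pt R)) (Th Eh : set (set (pt R))).
Hypotheses (hOmega : polygon Omega) (hmesh : polygonal_mesh Omega Th Eh).
Implicit Types (a b p q n v w x y : pt R) (e K : set (pt R)).

Lemma polygon_open (P : set (pt R)) : polygon P -> open P.
Proof. by move=> [_ _ _ <- _]; exact: open_interior. Qed.

Let oTh K : Th K -> open K.
Proof. by move=> /(mesh_polygon hmesh)/polygon_open. Qed.

Lemma closure_element K x : Th K -> closure K x -> K x \/ boundary K x.
Proof.
move=> ThK Kx; have [?|nKx] := pselect (K x); [by left|right; split => //].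
by rewrite (interior_id K).1//; exact: oTh.
Qed.

Lemma element_unique K K' x : Th K -> Th K' -> K x -> K' x -> K = K'.
Proof. by move=> ThK ThK' Kx K'x; apply: (mesh_disjoint hmesh) => //; exists x. Qed.

Lemma closure_element_inj K K' x : Th K -> Th K' -> closure K x -> K' x -> K x.
Proof.
move=> ThK ThK' cKx K'x; have [|z [Kz K'z]] := cKx K'.
  by apply: open_nbhs_nbhs; split => //; exact: oTh.
by rewrite (element_unique ThK ThK' Kz K'z).
Qed.

Lemma edge_boundary K x : Th K -> boundary K x ->
  exists e, [/\ Eh e, e `<=` boundary K & e x].
Proof.
move=> ThK bKx; have [e [Ee eK] ex] :
    (\bigcup_(e in [set e | Eh e /\ e `<=` boundary K]) e) x.
  by rewrite -(mesh_boundary hmesh ThK).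
by exists e.
Qed.

(** The edge lies in the boundary of some element [K']. A point of it inside [K] would be in the
    closure of [K'], hence in [K'] by disjointness of the open elements, and not on its boundary. *)
Lemma element_edge_disjoint K e x : Th K -> Eh e -> K x -> ~ e x.
Proof.
move=> ThK Ee Kx ex; have [K' ThK' eK'] := mesh_edge hmesh Ee.
have [cK'x] := eK' _ ex; rewrite (interior_id K').1; last exact: oTh.
by apply; exact: closure_element_inj ThK' ThK cK'x Kx.
Qed.

Lemma Omega_cover x : Omega x -> (\bigcup_(K in Th) K) x \/ (\bigcup_(e in Eh) e) x.
Proof.
move=> Ox; have : closure Omega x by exact: subset_closure.
rewrite (mesh_cover hmesh) => -[K ThK /(closure_element ThK)[Kx|bKx]].
  by left; exists K.
by have [e [? _ ?]] := edge_boundary ThK bKx; right; exists e.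
Qed.

(** [K] is an open subset of the closure of [Omega], and a regular open set is the interior of its
    closure. *)
Lemma element_sub_Omega K : Th K -> K `<=` Omega.
Proof.
move=> ThK; have [_ _ _ <- _] := hOmega.
rewrite -[K](interior_id K).1; last exact: oTh.
apply: interiorS; rewrite (mesh_cover hmesh) => x Kx; exists K => //.
exact: subset_closure.
Qed.

(** Connectedness: the trace of [K] on the segment is relatively open, and relatively closed because
    the segment is covered by disjoint open elements. *)
Lemma segment_in_element K a b : Th K -> K a ->
  segment a b `<=` \bigcup_(K in Th) K -> K b.
Proof.
move=> ThK Ka abU.
have seg_a : segment a b a.
  by exists 0; rewrite /= ?in_itv/= ?lexx ?ler01// subr0 scale1r scale0r addr0.
have seg_b : segment a b b.
  by exists 1; rewrite /= ?in_itv/= ?lexx ?ler01// subrr scale1r scale0r add0r.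
suff : segment a b `&` K = segment a b by move=> E; have := seg_b; rewrite -{1}E => -[].
apply: connected_segment_pt.
- by exists a.
- by exists K => //; exact: oTh.
- exists (closure K); first exact: closed_closure.
  apply/seteqP; split => x [xab Kx]; split => //; first exact: subset_closure.
  by have [K' ThK' K'x] := abU x xab; exact: closure_element_inj Kx K'x.
Qed.

(** The other edges form a finite union of closed sets, and conformity keeps [p] out of it since [p]
    is not an endpoint. *)
Lemma isolated_edge e p : Eh e -> e p -> ~ endpoints e p ->
  \forall y \near p, forall e', Eh e' -> e' y -> e' = e.
Proof.
move=> Ee ep Nep.
pose F := \bigcup_(e' in [set e' | Eh e' /\ e' <> e]) e'.
have cF : closed F.
  apply: closed_bigcup => [|e' [/(mesh_segment hmesh)[a [b [_ ->]]] _]]; last first.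
    exact: closed_segment_pt.
  by apply: sub_finite_set (mesh_finite hmesh).2 => e' [].
have Fp : ~ F p.
  move=> [e' [Ee' e'e] e'p]; apply: Nep.
  by have [] := mesh_conforming hmesh Ee Ee' (fun E => e'e (esym E)) (conj ep e'p).
have : \forall y \near p, (~` F) y.
  by apply: open_nbhs_nbhs; split => //; rewrite openC.
apply: filterS => y NFy e' Ee' e'y; apply: contrapT => e'e.
by apply: NFy; exists e'.
Qed.

(** A small half-box at [p] meets no edge, so it is covered by the elements; being convex, it lies
    in just one of them. *)
Lemma half_neighborhood e n p : Eh e -> unit_normal e n -> Omega p ->
  e p -> ~ endpoints e p ->
  exists K, [/\ Th K, e `<=` closure K & \forall y \near half_nbhs n p, K y].
Proof.
move=> Ee [n1 ne] Op ep Nep.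
have /near_boxP[d d0 dP] : \forall y \near p,
    Omega y /\ (forall e', Eh e' -> e' y -> e' = e).
  apply: filterI; last exact: isolated_edge.
  by apply: open_nbhs_nbhs; split => //; exact: polygon_open.
pose H y := [/\ `|y.1 - p.1| < d, `|y.2 - p.2| < d & 0 < dot n (y - p)].
have HU y : H y -> (\bigcup_(K in Th) K) y.
  move=> [y1 y2 ny]; have [/Omega_cover[//|[e' Ee' e'y]] ye] := dP y y1 y2.
  have ee' := ye e' Ee' e'y; rewrite ee' in e'y.
  by move: ny; rewrite ne// ltxx.
have n_le1 : `|n.1| <= 1 /\ `|n.2| <= 1.
  move: n1; rewrite dotE -!expr2 => n1.
  split; rewrite -(ler_pXn2r (n := 2))// ?nnegrE// expr1n real_normK ?num_real//.
  + by rewrite -n1 lerDl sqr_ge0.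
  + by rewrite -n1 lerDr sqr_ge0.
(* A base point of the half-box: the coordinates of a unit vector are at most 1 in absolute
   value. *)
pose y0 : pt R := p + (d / 2) *: n.
have Hy0 : H y0.
  have d2 : `|d / 2| = d / 2 by rewrite ger0_norm// divr_ge0// ltW.
  split.
  - rewrite /y0 /= addrAC subrr add0r [`|_|]normrM d2.
    by apply: (@le_lt_trans _ _ (d / 2)); [rewrite ler_piMr//; [lra|exact: n_le1.1]|lra].
  - rewrite /y0 /= addrAC subrr add0r [`|_|]normrM d2.
    by apply: (@le_lt_trans _ _ (d / 2)); [rewrite ler_piMr//; [lra|exact: n_le1.2]|lra].
  - rewrite /y0 addrC addKr.
    by rewrite dotZr n1; lra.
have [K ThK Ky0] := HU y0 Hy0; clearbody y0.
(* The segment from [y0] to [y] stays in the half-box by convexity, so it cannot leave the element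
   of [y0]. *)
have HK y : H y -> K y.
  move=> Hy; apply: (segment_in_element ThK Ky0) => _ [s s01 <-]; apply: HU.
  move: s01; rewrite /= in_itv/= => /andP[s0 s1].
  case: Hy0 => u1 u2 u3; case: Hy => v1 v2 v3.
  have pos (u v : R) : 0 < u -> 0 < v -> 0 < (1 - s) * u + s * v.
    move=> u_0 v_0; have [->|s_0] := eqVneq s 0; first by rewrite subr0 mul1r mul0r addr0.
    have s_gt0 : 0 < s by rewrite lt_neqAle eq_sym s_0 s0.
    by rewrite ltr_wpDl ?mulr_gt0// mulr_ge0 ?subr_ge0// ltW.
  have cvx (u v : R) : `|u| < d -> `|v| < d -> `|(1 - s) * u + s * v| < d.
    rewrite !ltr_norml => /andP[ul ur] /andP[vl vr].
    have P1 : 0 < (1 - s) * (d - u) + s * (d - v) by apply: pos; rewrite subr_gt0.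
    have P2 : 0 < (1 - s) * (u + d) + s * (v + d) by apply: pos; rewrite -ltrBlDr sub0r.
    by apply/andP; split; lra.
  split.
  - rewrite (_ : _ - _ = (1 - s) * (y0.1 - p.1) + s * (y.1 - p.1)); first exact: cvx.
    by rewrite -[LHS]/((1 - s) * y0.1 + s * y.1 - p.1); ring.
  - rewrite (_ : _ - _ = (1 - s) * (y0.2 - p.2) + s * (y.2 - p.2)); first exact: cvx.
    by rewrite -[LHS]/((1 - s) * y0.2 + s * y.2 - p.2); ring.
  - have -> : dot n ((1 - s) *: y0 + s *: y - p) =
      (1 - s) * dot n (y0 - p) + s * dot n (y - p).
      by rewrite !dotDr !dotZr dotNr; ring.
    exact: pos.
exists K; split => //; last first.
  rewrite /half_nbhs; apply/near_boxP; exists d => // y y1 y2 /= ny.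
  exact: HK.
have nHK : \forall y \near half_nbhs n p, K y.
  rewrite /half_nbhs; apply/near_boxP; exists d => // y y1 y2 /= ny.
  exact: HK.
have cKp : closure K p.
  move=> B nB; have PF := half_nbhs_proper p n1.
  have : \forall y \near half_nbhs n p, K y /\ B y.
    by apply: filterI => //; apply: cvg_within.
  by move=> /filter_ex[y [Ky By]]; exists y.
(* As [p] is on the boundary of [K], an edge of [K] passes through it. By conformity this edge is
   [e], so all of [e] lies in the closure of [K]. *)
have [Kp|bKp] := closure_element ThK cKp.
  by have := element_edge_disjoint ThK Ee Kp.
have [e' [Ee' e'K e'p]] := edge_boundary ThK bKp.
suff <- : e' = e by move=> x /e'K[].
apply: contrapT => e'e; apply: Nep.
by have [] := mesh_conforming hmesh Ee Ee' (fun E => e'e (esym E)) (conj ep e'p).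
Qed.

End mesh_geometry.

(** * Piecewise continuous functions and their traces on edges *)

Lemma near_finite_set (I : choiceType) (T : Type) (F : set_system T) (D : set I)
    (P : I -> T -> Prop) : Filter F -> finite_set D ->
  (forall i, D i -> \forall x \near F, P i x) ->
  \forall x \near F, forall i, D i -> P i x.
Proof.
move=> FF /finite_seqP[s ->]; elim: s => [_|i s IHs H].
  by apply: filterE => x i.
have Hi : \forall x \near F, P i x by apply: H; rewrite /= inE eqxx.
have Hs : \forall x \near F, forall j, [set` s] j -> P j x.
  by apply: IHs => j js; apply: H; rewrite /= inE js orbT.
apply: filterS2 Hi Hs => x Pi Ps j; rewrite /= inE => /orP[/eqP->//|js].
exact: Ps.
Qed.

Section piecewise_continuity.
Context {R : realType} (Th : set (set (pt R))).
Implicit Types (u v : pt R -> R) (K : set (pt R)) (n p x y w : pt R).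

Definition piecewise_continuous u := forall K, Th K -> Ck_closure 0 K u.

Lemma piecewise_continuousD u v : piecewise_continuous u ->
  piecewise_continuous v -> piecewise_continuous (fun x => u x + v x).
Proof.
move=> pu pv K ThK; have [[f [cf uf]] _] := pu K ThK; have [[g [cg vg]] _] := pv K ThK.
split => //; exists (fun x => f x + g x); split; last by move=> x Kx; rewrite uf ?vg.
by move=> x; apply: cvgD; [exact: cf|exact: cg].
Qed.

Lemma piecewise_continuousM u v : piecewise_continuous u ->
  piecewise_continuous v -> piecewise_continuous (fun x => u x * v x).
Proof.
move=> pu pv K ThK; have [[f [cf uf]] _] := pu K ThK; have [[g [cg vg]] _] := pv K ThK.
split => //; exists (fun x => f x * g x); split; last by move=> x Kx; rewrite uf ?vg.
by move=> x; apply: cvgM; [exact: cf|exact: cg].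
Qed.

Lemma continuous_piecewise u : continuous u -> piecewise_continuous u.
Proof.
move=> cu K ThK; split => //; exists u; split => //.
exact: continuous_subspaceT.
Qed.

Lemma piecewise_continuousN u : piecewise_continuous u ->
  piecewise_continuous (fun x => - u x).
Proof.
move=> pu K ThK; have [[f [cf uf]] _] := pu K ThK.
split => //; exists (fun x => - f x); split; last by move=> x Kx; rewrite uf.
by move=> x; apply: cvgN; exact: cf.
Qed.

Lemma closure_within_proper K x : closure K x -> ProperFilter (within K (nbhs x)).
Proof.
move=> Kx; apply: Build_ProperFilter_ex => P nP.
by have [y [Ky Py]] := Kx _ nP; exists y; exact: Py.
Qed.

Lemma piecewise_trace_ext u K : piecewise_continuous u -> Th K ->
  exists g, [/\ {within closure K, continuous g}, forall x, K x -> u x = g x,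
   forall x, closure K x -> u y @[y --> within K (nbhs x)] --> g x &
   forall x, closure K x -> trace_from K u x = g x].
Proof.
move=> pu ThK; have [[g [cg ug]] _] := pu K ThK.
have cvg_g x : closure K x -> u y @[y --> within K (nbhs x)] --> g x.
  move=> Kx; have /subspace_continuousP/(_ x Kx) gx := cg.
  apply: cvg_trans (cvg_trans (_ : g y @[y --> within K (nbhs x)] --> _) gx).
    apply: near_eq_cvg; apply: (@filterE _ (nbhs x)) => y Ky; exact/esym/ug.
  apply: cvg_app => P nP; suff : \forall y \near x, K y -> P y by [].
  have : \forall y \near x, closure K y -> P y by exact: nP.
  by apply: filterS => y PP Ky; apply: PP; exact: subset_closure.
exists g; split => // x Kx; have := closure_within_proper Kx => PF.
by rewrite /trace_from; apply/cvg_lim => //; exact: cvg_g.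
Qed.

Lemma piecewise_trace u K x : piecewise_continuous u -> Th K -> closure K x ->
  u y @[y --> within K (nbhs x)] --> trace_from K u x.
Proof. by move=> pu ThK Kx; have [g [_ _ ug ->//]] := piecewise_trace_ext pu ThK; exact: ug. Qed.

Lemma half_nbhs_within K n p : (\forall y \near half_nbhs n p, K y) ->
  half_nbhs n p --> within K (nbhs p).
Proof.
move=> nK P nP; suff : \forall y \near p, 0 < dot n (y - p) -> P y by [].
have {}nK : \forall y \near p, 0 < dot n (y - p) -> K y by [].
have {}nP : \forall y \near p, K y -> P y by [].
by apply: filterS2 nK nP => y nK nP /nK.
Qed.

Lemma half_nbhs_trace u K n p : piecewise_continuous u -> Th K -> closure K p ->
  (\forall y \near half_nbhs n p, K y) ->
  u y @[y --> half_nbhs n p] --> trace_from K u p.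
Proof.
move=> pu ThK Kp nK; apply: cvg_trans (piecewise_trace pu ThK Kp).
exact/cvg_app/half_nbhs_within.
Qed.

Definition half_lim n u p : R := lim (u y @[y --> half_nbhs n p]).

(** Half-plane limits, rather than traces from two adjacent elements, give the jump a meaning on
    boundary edges too; there it is 0 for functions that vanish near the boundary. *)
Definition jump n u p : R := half_lim n u p - half_lim (- n) u p.

End piecewise_continuity.

Lemma compact_closure_bounded (R : realType) (A : set (pt R)) :
  bounded_set A -> compact (closure A).
Proof.
move=> [M [_ MA]]; pose m := M + 1.
have Am x : A x -> (`[- m, m]%classic `*` `[- m, m]%classic) x.
  move=> Ax; have : Num.max `|x.1| `|x.2| <= m.
    by apply: (MA m _ x Ax); rewrite /m ltrDl.
  rewrite ge_max => /andP[x1 x2].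
  by split; rewrite /= in_itv/= -ler_norml.
apply: (@subclosed_compact _ _ (`[- m, m] `*` `[- m, m])).
- exact: closed_closure.
- by apply: compact_setX; exact: segment_compact.
- apply: (@subset_trans _ (closure (`[- m, m] `*` `[- m, m]))); first exact: closureS.
  have : closed (`[- m, m]%classic `*` `[- m, m]%classic : set (pt R)).
    apply: compact_closed; first exact: norm_hausdorff.
    by apply: compact_setX; exact: segment_compact.
  by rewrite closure_id => <-.
Qed.

Lemma piecewise_bounded (R : realType) (Th : set (set (pt R))) (u : pt R -> R) :
  finite_set Th -> (forall K, Th K -> bounded_set K) -> piecewise_continuous Th u ->
  exists2 C : R, 0 < C & forall x, (\bigcup_(K in Th) K) x -> `|u x| <= C.
Proof.
move=> fTh bTh pu.
have : \forall C \near +oo, forall K, Th K -> forall x, K x -> `|u x| <= C.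
  apply: near_finite_set => // K ThK; have [[g [cg ug]] _] := pu K ThK.
  have /compact_bounded := continuous_compact cg (compact_closure_bounded (bTh K ThK)).
  move=> [C [Cr Cg]]; exists C; split => // D CD x Kx; rewrite ug//.
  by apply: Cg => //; exists x => //; exact: subset_closure.
move=> [C [_ CP]]; exists (`|C| + 1); first by rewrite ltr_wpDl.
move=> x [K ThK Kx]; apply: CP Kx => //.
by rewrite ltr_pwDr// ler_norm.
Qed.

Definition edge_point (R : realType) (a b : pt R) (s : R) : pt R :=
  (1 - s) *: a + s *: b.

(** * One-sided limits along an open edge *)

Section edge_traces.
Context {R : realType} (Omega : set (pt R)) (Th Eh : set (set (pt R))).
Hypotheses (hOmega : polygon Omega) (hmesh : polygonal_mesh Omega Th Eh).
Variables (S : set (pt R)).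
Hypotheses (cS : closed S) (SO : S `<=` Omega).
Implicit Types (u v : pt R -> R) (K : set (pt R)) (p x y w : pt R).

(** [S] stands for the support of the test function. At an edge point in [S], which is then in
    [Omega], an element fills each side; at any other point the function vanishes nearby. Either way
    the half-plane limits exist. *)
Definition supported_in u := forall x, ~ S x -> u x = 0.

Lemma supported_near u p : supported_in u -> ~ S p -> \forall y \near p, u y = 0.
Proof.
move=> su Sp; have : \forall y \near p, (~` S) y.
  by apply: open_nbhs_nbhs; split => //; rewrite openC.
by apply: filterS => y /su.
Qed.

Variables (a b n : pt R).
Hypotheses (ab : a != b) (Ee : Eh (segment a b)) (hn : unit_normal (segment a b) n).

Let gam := edge_point a b.

Let gamE (s : R) : gam s = a + s *: (b - a). Proof. exact: segment_param. Qed.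

Let cgam : continuous gam.
Proof.
by have -> : gam = (fun s => a + s *: (b - a)); [apply/funext|exact: continuous_affine_pt].
Qed.

Let near_gam (F : set_system R) p (P : set (pt R)) : gam s @[s --> F] --> p ->
  (\forall y \near p, P y) -> \forall t \near F, \forall y \near gam t, P y.
Proof. by move=> Fp nP; exact: (Fp _ (nbhs_interior nP)). Qed.

Let near_gam0 (F : set_system R) p (P : set (pt R)) : gam s @[s --> F] --> p ->
  (\forall y \near p, P y) -> \forall t \near F, P (gam t).
Proof. by move=> Fp nP; exact: (Fp _ nP). Qed.

Let gam_seg (s : R) : s \in `[0, 1] -> segment a b (gam s).
Proof. by move=> s01; exists s. Qed.

Let gam_int (s : R) : s \in `]0, 1[ -> segment a b (gam s) /\ ~ endpoints (segment a b) (gam s).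
Proof. by move=> s01; exact: segment_interior_point. Qed.

Let n1 : dot n n = 1. Proof. by case: hn. Qed.

Let properH p : ProperFilter (half_nbhs n p).
Proof. exact: half_nbhs_proper. Qed.

Let near01 (s : R) : s \in `]0, 1[ -> \forall t \near s, t \in `]0, 1[.
Proof. by move=> s01; exact: near_in_itvoo. Qed.

Let normal_b_a : dot n (b - a) = 0.
Proof. exact: unit_normal_segment. Qed.

Lemma half_neighborhood_edge (s : R) : s \in `]0, 1[ -> Omega (gam s) ->
  exists K, [/\ Th K, segment a b `<=` closure K
             & \forall y \near half_nbhs n (gam s), K y].
Proof.
move=> s01 Os; have [es Nes] := gam_int s01.
exact: (half_neighborhood hOmega hmesh Ee hn Os es Nes).
Qed.

(** The normal is orthogonal to the edge, so all points of the edge define the same open half-plane,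
    and the element found at one of them also serves its neighbours. *)
Lemma half_nbhs_near (s : R) K : s \in `]0, 1[ ->
  (\forall y \near half_nbhs n (gam s), K y) ->
  \forall t \near s, \forall y \near half_nbhs n (gam t), K y.
Proof.
move=> s01 nK; have {}nK : \forall y \near gam s, 0 < dot n (y - gam s) -> K y by [].
have := near_gam (@cgam s) nK; apply: filterS => t nKt.
suff : \forall y \near gam t, 0 < dot n (y - gam t) -> K y by [].
have {}nKt : \forall y \near gam t, 0 < dot n (y - gam s) -> K y by [].
apply: filterS nKt => y Ky nyt; apply: Ky; rewrite [_ < _](_ : _ = (0 < dot n (y - gam t)))//.
congr (_ < _); rewrite !gamE !opprD !dotDr !dotNr !dotZr normal_b_a; ring.
Qed.

Lemma half_lim0 u p : (\forall y \near p, u y = 0) -> u y @[y --> half_nbhs n p] --> (0 : R).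
Proof.
move=> nu; apply: cvg_near_cst.
suff : \forall y \near p, 0 < dot n (y - p) -> u y = 0 by [].
by apply: filterS nu.
Qed.

Lemma half_lim_eq0 u p : (\forall y \near p, u y = 0) -> half_lim n u p = 0.
Proof. by move=> /half_lim0 H; exact/cvg_lim. Qed.

Lemma cvg_half_lim u (s : R) : piecewise_continuous Th u -> supported_in u ->
  s \in `]0, 1[ -> u y @[y --> half_nbhs n (gam s)] --> half_lim n u (gam s).
Proof.
move=> pu su s01; have [Ss|nSs] := pselect (S (gam s)); last first.
  by apply/cvg_ex; exists 0; exact/half_lim0/supported_near.
have [K [ThK eK nK]] := half_neighborhood_edge s01 (SO Ss).
apply/cvg_ex; exists (trace_from K u (gam s));
  exact: (half_nbhs_trace pu ThK (eK _ (gam_seg (subset_itv_oo_cc s01))) nK).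
Qed.

Lemma half_lim_trace u (s : R) K : piecewise_continuous Th u -> s \in `]0, 1[ ->
  Th K -> segment a b `<=` closure K ->
  (\forall y \near half_nbhs n (gam s), K y) -> half_lim n u (gam s) = trace_from K u (gam s).
Proof.
move=> pu s01 ThK eK nK; apply/cvg_lim => //;
  exact: (half_nbhs_trace pu ThK (eK _ (gam_seg (subset_itv_oo_cc s01))) nK).
Qed.

(** Near an edge point in [S] one element serves all neighbouring points, and the half-plane limits
    are the values of the continuous extension from that element. *)
Lemma continuous_half_lim u (s : R) : piecewise_continuous Th u -> supported_in u ->
  s \in `]0, 1[ -> {for s, continuous (fun t => half_lim n u (gam t))}.
Proof.
move=> pu su s01.
suff : half_lim n u (gam t) @[t --> s] --> half_lim n u (gam s) by [].
have [Ss|nSs] := pselect (S (gam s)); last first.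
  have nS : \forall t \near s, \forall y \near gam t, u y = 0.
    exact: near_gam (@cgam s) (supported_near su nSs).
  rewrite half_lim_eq0; last exact: supported_near.
  by apply: cvg_near_cst; apply: filterS nS => t /half_lim_eq0.
have [K [ThK eK nK]] := half_neighborhood_edge s01 (SO Ss).
have [g [cg ug gK gE]] := piecewise_trace_ext pu ThK.
have cl t : t \in `]0, 1[ -> closure K (gam t).
  by move=> t01; apply: eK; exact: gam_seg (subset_itv_oo_cc t01).
rewrite (half_lim_trace pu s01 ThK eK nK) gE; last exact: cl.
apply: (@cvg_trans _ (g (gam t) @[t --> s])).
  apply: near_eq_cvg; apply: filterS2 (near01 s01) (half_nbhs_near s01 nK) => t t01 nKt.
  by rewrite (half_lim_trace pu t01 ThK eK nKt) gE//; exact: cl.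
have /subspace_continuousP/(_ _ (cl _ s01)) gs := cg.
apply: cvg_trans gs => P nP.
have {}nP : \forall y \near gam s, closure K y -> P (g y) by [].
have := near_gam0 (@cgam s) nP; apply: filterS2 (near01 s01) => t t01.
by apply; exact: cl.
Qed.

Lemma half_lim_bounded u (C s : R) : piecewise_continuous Th u -> supported_in u ->
  0 <= C -> (forall x, (\bigcup_(K in Th) K) x -> `|u x| <= C) ->
  s \in `]0, 1[ -> `|half_lim n u (gam s)| <= C.
Proof.
move=> pu su C0 uC s01; have [Ss|nSs] := pselect (S (gam s)); last first.
  by rewrite half_lim_eq0 ?normr0//; exact: supported_near.
have [K [ThK eK nK]] := half_neighborhood_edge s01 (SO Ss).
have cu : `|u y| @[y --> half_nbhs n (gam s)] --> `|half_lim n u (gam s)|.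
  by apply: cvg_norm; exact: cvg_half_lim.
apply: (cvgr_to_le cu); first exact: properH.
by apply: filterS nK => y Ky; apply: uC; exists K.
Qed.

(** The element beside the edge is known only point by point as a vertex is approached. The estimate
    [|l - u y| <= e] is therefore established near [p] on all elements at once, which is possible
    since they are finitely many, and then passes to the half-plane limits. *)
Lemma half_lim_vertex u p (l : R) (F : set_system R) : Filter F ->
  piecewise_continuous Th u -> supported_in u ->
  (S p -> forall K, Th K -> closure K p -> u y @[y --> within K (nbhs p)] --> l) ->
  (~ S p -> l = 0) ->
  gam s @[s --> F] --> p -> (\forall s \near F, s \in `]0, 1[) ->
  half_lim n u (gam s) @[s --> F] --> l.
Proof.
move=> FF pu su ul l0 Fp F01; have [Sp|nSp] := pselect (S p); last first.
  rewrite l0//; apply: cvg_near_cst.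
  have := near_gam Fp (supported_near su nSp).
  by apply: filterS => t /half_lim_eq0.
apply/cvgrPdist_le => e e0.
have nall : \forall y \near p, forall K, Th K -> K y -> `|l - u y| <= e.
  apply: (@near_finite_set _ _ (nbhs p) Th (fun K y => K y -> `|l - u y| <= e));
    first exact: (mesh_finite hmesh).1.
  move=> K ThK; have [Kp|nKp] := pselect (closure K p).
    by have /cvgrPdist_le/(_ e e0) := ul Sp K ThK Kp.
  have : \forall y \near p, (~` closure K) y.
    by apply: open_nbhs_nbhs; split => //; rewrite openC; exact: closed_closure.
  by apply: filterS => y nKy Ky; exfalso; apply: nKy; exact: subset_closure.
have nO : \forall y \near p, Omega y.
  by apply: open_nbhs_nbhs; split; [exact: polygon_open|exact: SO].
have := near_gam Fp nall; have := near_gam0 Fp nO.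
apply: filterS3 F01 => s s01 Os ns.
have [K [ThK eK nK]] := half_neighborhood_edge s01 Os.
have cu : `|l - u y| @[y --> half_nbhs n (gam s)] --> `|l - half_lim n u (gam s)|.
  by apply: cvg_norm; apply: cvgB; [exact: cvg_cst|exact: cvg_half_lim].
apply: (cvgr_to_le cu); first exact: properH.
have {}ns : \forall y \near half_nbhs n (gam s), forall K, Th K -> K y -> `|l - u y| <= e.
  suff : \forall y \near gam s, 0 < dot n (y - gam s) ->
    forall K, Th K -> K y -> `|l - u y| <= e by [].
  by apply: filterS ns => y Hy _; exact: Hy.
by apply: filterS2 nK ns => y Ky Hy; exact: Hy Ky.
Qed.

(** Taking the trace commutes with differentiating along the edge. The piece of edge between [gam s]
    and [gam t] is shifted into the element by [h n], the mean value theorem is applied on the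
    shifted segment, and [h] tends to 0 from the right. *)
Lemma is_derive_half_lim u du (s : R) :
  piecewise_continuous Th u -> supported_in u ->
  piecewise_continuous Th du -> supported_in du ->
  (forall x, (\bigcup_(K in Th) K) x -> is_derive x (b - a) u (du x)) ->
  s \in `]0, 1[ ->
  is_derive s (1 : R) (fun t => half_lim n u (gam t)) (half_lim n du (gam s)).
Proof.
move=> pu su pdu sdu Du s01; apply: is_derive1P => e e0.
have [Ss|nSs] := pselect (S (gam s)); last first.
  rewrite (half_lim_eq0 (u := du)); last exact: supported_near.
  rewrite (half_lim_eq0 (p := gam s)); last exact: supported_near.
  have := near_gam (@cgam s) (supported_near su nSs).
  apply: filterS => t /half_lim_eq0 ->.
  by rewrite subrr mulr0 subrr normr0 mulr_ge0// ltW.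
have [K [ThK eK nK]] := half_neighborhood_edge s01 (SO Ss).
have cdu := cvg_half_lim pdu sdu s01.
have ndu : \forall y \near half_nbhs n (gam s), `|half_lim n du (gam s) - du y| <= e.
  by have /cvgrPdist_le/(_ e e0) := cdu.
have {ndu} : \forall y \near half_nbhs n (gam s),
  K y /\ `|half_lim n du (gam s) - du y| <= e by exact: filterI nK ndu.
move=> ndu; have /near_boxP[d d0 dP] : \forall y \near gam s, 0 < dot n (y - gam s) ->
  K y /\ `|half_lim n du (gam s) - du y| <= e by [].
(* A point of the shifted segment differs from [gam s] by a normal shift and a move along the edge.
   Each is kept below [d / 2] in both coordinates, so the point stays in the box of size [d]. *)
pose m := `|(b - a).1| + `|(b - a).2| + 1.
have m0 : 0 < m by rewrite ltr_wpDl// addr_ge0.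
have dm : 0 < d / 2 / m by rewrite !divr_gt0.
have nt : \forall t \near s, `|s - t| < d / 2 / m.
  by apply/nbhs_ballP; exists (d / 2 / m).
apply: filterS2 (near01 s01) nt => t t01 std.
pose r := t - s.
have rd : `|r| * m < d / 2 by rewrite -ltr_pdivlMr// /r distrC.
have gtE : gam t = gam s + r *: (b - a).
  by rewrite !gamE -addrA -scalerDl /r addrCA subrr addr0.
pose w : pt R := n.
have nw : 0 < dot n w by rewrite n1.
have Hs : (u (gam s + h *: w)) @[h --> (0:R)^'+] --> half_lim n u (gam s).
  exact: cvg_trans (cvg_app u (half_nbhs_ray (p := gam s) nw)) (cvg_half_lim pu su s01).
have Ht : (u (gam t + h *: w)) @[h --> (0:R)^'+] --> half_lim n u (gam t).
  exact: cvg_trans (cvg_app u (half_nbhs_ray (p := gam t) nw)) (cvg_half_lim pu su t01).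
have lim_norm : `|u (gam t + h *: w) - u (gam s + h *: w) - r * half_lim n du (gam s)|
    @[h --> (0:R)^'+] --> `|half_lim n u (gam t) - half_lim n u (gam s)
       - r * half_lim n du (gam s)|.
  by apply: cvg_norm; apply: (cvgB (cvgB Ht Hs)); exact: cvg_cst.
apply: (cvgr_to_le lim_norm).
have nwd : \forall h \near (0:R)^'+, `|h| * (`|w.1| + `|w.2| + 1) < d / 2.
  apply: cvg_within.
  have M0 : 0 < `|w.1| + `|w.2| + 1 by rewrite ltr_wpDl// addr_ge0.
  have := @nbhs0_lt _ R _ (divr_gt0 (divr_gt0 d0 (ltr0Sn R 1)) M0).
  by apply: filterS => h; rewrite ltr_pdivlMr.
apply: filterS2 (nbhs_right_gt (0 : R)) nwd => h h0 hd.
pose q := gam s + h *: w.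
have inbox z : `|z| <= `|r| -> K (q + z *: (b - a)) /\
    `|half_lim n du (gam s) - du (q + z *: (b - a))| <= e.
  move=> zr; apply: dP.
  - rewrite (_ : _ - _ = h * w.1 + z * (b - a).1); last first.
      by rewrite -[LHS]/((gam s).1 + h * w.1 + z * (b - a).1 - (gam s).1); ring.
    apply: le_lt_trans (ler_normD _ _) _; rewrite !normrM.
    have A1 : `|h| * `|w.1| <= `|h| * (`|w.1| + `|w.2| + 1).
      by rewrite ler_wpM2l// -addrA lerDl addr_ge0.
    have A2 : `|z| * `|(b - a).1| <= `|r| * m.
      by rewrite ler_pM// /m -addrA lerDl addr_ge0.
    have -> : d = d / 2 + d / 2 by field.
    by apply: ler_ltD (le_trans A1 (ltW hd)) (le_lt_trans A2 rd).
  - rewrite (_ : _ - _ = h * w.2 + z * (b - a).2); last first.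
      by rewrite -[LHS]/((gam s).2 + h * w.2 + z * (b - a).2 - (gam s).2); ring.
    apply: le_lt_trans (ler_normD _ _) _; rewrite !normrM.
    have A1 : `|h| * `|w.2| <= `|h| * (`|w.1| + `|w.2| + 1).
      by rewrite ler_wpM2l// addrAC lerDr addr_ge0.
    have A2 : `|z| * `|(b - a).2| <= `|r| * m.
      by rewrite ler_pM// /m addrAC lerDr addr_ge0.
    have -> : d = d / 2 + d / 2 by field.
    by apply: ler_ltD (le_trans A1 (ltW hd)) (le_lt_trans A2 rd).
  - have -> : dot n (q + z *: (b - a) - gam s) = h * dot n w.
      have nb : dot n b = dot n a.
        by apply/eqP; rewrite -subr_eq0 -dotNr -dotDr normal_b_a.
      by rewrite /q !(dotDr, dotZr, dotNr) nb; ring.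
    exact: mulr_gt0.
have [z zr E] : exists2 z, `|z| <= `|r| &
    u (q + r *: (b - a)) - u q = r * du (q + z *: (b - a)).
  apply: mean_value_line => z zr; apply: Du; exists K => //.
  by have [] := inbox z zr.
rewrite (_ : gam t + h *: w = q + r *: (b - a)); last first.
  by rewrite gtE /q addrAC.
rewrite E -mulrBr normrM mulrC ler_wpM2r// distrC.
by have [] := inbox z zr.
Qed.

End edge_traces.

(** * Jumps and their integrals over an edge *)

Section edge_jumps.
Context {R : realType} (Omega : set (pt R)) (Th Eh : set (set (pt R))).
Hypotheses (hOmega : polygon Omega) (hmesh : polygonal_mesh Omega Th Eh).
Variables (S : set (pt R)).
Hypotheses (cS : closed S) (SO : S `<=` Omega).
Implicit Types (u v : pt R -> R) (K : set (pt R)) (p x y w : pt R).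
Variables (a b n : pt R).
Hypotheses (ab : a != b) (Ee : Eh (segment a b)) (hn : unit_normal (segment a b) n).
Notation mu := (@lebesgue_measure R).

Let hnN : unit_normal (segment a b) (- n). Proof. exact: unit_normalN. Qed.

Lemma piecewise_mesh_bounded u : piecewise_continuous Th u ->
  exists2 C : R, 0 < C & forall x, (\bigcup_(K in Th) K) x -> `|u x| <= C.
Proof.
move=> pu; apply: piecewise_bounded => //; first exact: (mesh_finite hmesh).1.
by move=> K /(mesh_polygon hmesh)[].
Qed.

Let near_restrict (f : R -> R) (s : R) : s \in `]0, 1[ ->
  \forall t \near s, f t = (f \_ `]0, 1[) t.
Proof.
move=> s01; apply: filterS (near_in_itvoo s01) => t t01.
by rewrite patchE mem_set.
Qed.

Lemma continuous_jump u (s : R) : piecewise_continuous Th u -> supported_in S u ->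
  s \in `]0, 1[ -> {for s, continuous (fun t => jump n u (edge_point a b t))}.
Proof.
move=> pu su s01.
apply: (@cvgB _ _ _ _ _ (fun t => half_lim n u (edge_point a b t))
                        (fun t => half_lim (- n) u (edge_point a b t))).
- exact: (continuous_half_lim hOmega hmesh cS SO ab Ee hn pu su s01).
- exact: (continuous_half_lim hOmega hmesh cS SO ab Ee hnN pu su s01).
Qed.

Lemma integrable_jump u : piecewise_continuous Th u -> supported_in S u ->
  mu.-integrable setT (EFin \o ((fun s => jump n u (edge_point a b s)) \_ `]0, 1[)).
Proof.
move=> pu su; rewrite -restrict_EFin.
apply/integrable_restrict => //=; rewrite setTI.
apply: measurable_bounded_integrable => //.
- by rewrite /= lebesgue_measure_itv/= lte_fin ltr01 -EFinB ltry.
- apply: open_continuous_measurable_fun; first exact: interval_open.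
  by move=> s; rewrite inE/= => s01; exact: continuous_jump.
have [C C0 uC] := piecewise_mesh_bounded pu.
exists (C + C); split; [exact: num_real|move=> M CM s s01].
apply: le_trans (ltW CM); apply: le_trans (ler_normB _ _) _; apply: lerD.
- exact: (half_lim_bounded hOmega hmesh cS SO ab Ee hn pu su (ltW C0) uC s01).
- exact: (half_lim_bounded hOmega hmesh cS SO ab Ee hnN pu su (ltW C0) uC s01).
Qed.

Let continuous_edge_point : continuous (edge_point a b).
Proof.
have -> : edge_point a b = (fun s => a + s *: (b - a)).
  by apply/funext => s; exact: segment_param.
exact: continuous_affine_pt.
Qed.

(** The jump of [u] is a primitive of the jump of [du] on the open edge. At an endpoint both
    half-plane limits of [u] tend to the same value: the limit common to all elements if the
    endpoint is in [S], and 0 otherwise. *)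
Lemma integral_jump_tangential u du :
  piecewise_continuous Th u -> supported_in S u ->
  piecewise_continuous Th du -> supported_in S du ->
  (forall x, (\bigcup_(K in Th) K) x -> is_derive x (b - a) u (du x)) ->
  (forall p, p = a \/ p = b -> S p -> exists l : R, forall K, Th K -> closure K p ->
     u y @[y --> within K (nbhs p)] --> l) ->
  \int[mu]_(s in `]0, 1[) jump n du (edge_point a b s) = 0.
Proof.
move=> pu su pdu sdu Du uv.
pose f := (fun s => jump n du (edge_point a b s)) \_ `]0, 1[.
pose F s := jump n u (edge_point a b s).
have fE s : s \in `]0, 1[ -> f s = jump n du (edge_point a b s).
  by move=> s01; rewrite /f patchE mem_set.
transitivity (\int[mu]_(s in `]0, 1[) f s).
  by apply: eq_Rintegral => s; rewrite inE/= => s01; rewrite fE.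
have vertex p (G : set_system R) : ProperFilter G -> p = a \/ p = b ->
    edge_point a b s @[s --> G] --> p ->
    (\forall s \near G, s \in `]0, 1[) -> F s @[s --> G] --> 0.
  move=> PG pab Gp G01.
  have [Sp|nSp] := pselect (S p); last first.
    rewrite -(subrr (0 : R)); apply: cvgB.
    - exact: (half_lim_vertex hOmega hmesh cS SO ab Ee hn _ pu su _ _ Gp).
    - exact: (half_lim_vertex hOmega hmesh cS SO ab Ee hnN _ pu su _ _ Gp).
  have [l ul] := uv p pab Sp.
  rewrite -(subrr l); apply: cvgB.
  - exact: (half_lim_vertex hOmega hmesh cS SO ab Ee hn _ pu su _ _ Gp).
  - exact: (half_lim_vertex hOmega hmesh cS SO ab Ee hnN _ pu su _ _ Gp).
apply: (@integral_derive_oo0 _ f F) => //.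
- apply: integrableS (integrable_jump pdu sdu) => //.
- move=> s s01; have := continuous_jump pdu sdu s01.
  rewrite /continuous_at fE// => cj; apply: cvg_trans cj.
  by apply: near_eq_cvg; exact: near_restrict.
- move=> s s01; rewrite fE//.
  apply: is_deriveB.
  + exact: (is_derive_half_lim hOmega hmesh cS SO ab Ee hn pu su pdu sdu Du s01).
  + exact: (is_derive_half_lim hOmega hmesh cS SO ab Ee hnN pu su pdu sdu Du s01).
- apply: (vertex a); [by left| |].
  + have E : edge_point a b 0 = a by rewrite /edge_point subr0 scale1r scale0r addr0.
    rewrite -[X in _ --> X]E; exact: (cvg_at_right_filter (@continuous_edge_point 0)).
  + near=> s; rewrite in_itv/=; apply/andP; split; near: s;
      [exact: nbhs_right_gt|exact: nbhs_right_lt].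
- apply: (vertex b); [by right| |].
  + have E : edge_point a b 1 = b by rewrite /edge_point subrr scale1r scale0r add0r.
    rewrite -[X in _ --> X]E; exact: (cvg_at_left_filter (@continuous_edge_point 1)).
  + near=> s; rewrite in_itv/=; apply/andP; split; near: s;
      [exact: nbhs_left_gt|exact: nbhs_left_lt].
Unshelve. all: by end_near.
Qed.

End edge_jumps.

(** * From half-plane limits to one-sided limits on lines *)

Section coordinate_slices.
Context {R : realType}.
Implicit Types (u : pt R -> R) (n p : pt R).

Lemma half_nbhs_slice1 n p (P : set (pt R)) : half_nbhs n p P ->
  \forall x \near p.1, 0 < n.1 * (x - p.1) -> P (x, p.2).
Proof.
move=> nP.
have /near_boxP[d d0 dP] : \forall y \near p, 0 < dot n (y - p) -> P y by [].
apply/nbhs_ballP; exists d => // x; rewrite /ball/= distrC => xd nx.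
by apply: dP; rewrite ?dotE/= ?subrr ?normr0// mulr0 addr0.
Qed.

Lemma half_nbhs_slice2 n p (P : set (pt R)) : half_nbhs n p P ->
  \forall y \near p.2, 0 < n.2 * (y - p.2) -> P (p.1, y).
Proof.
move=> nP.
have /near_boxP[d d0 dP] : \forall y \near p, 0 < dot n (y - p) -> P y by [].
apply/nbhs_ballP; exists d => // x; rewrite /ball/= distrC => xd nx.
by apply: dP; rewrite ?dotE/= ?subrr ?normr0// mulr0 add0r.
Qed.

(* The one-sided limits along a coordinate axis are the half-plane limits; the
   sign of the component [c] of the normal decides which is which. *)
Lemma slice_limits (f : R -> R) (z c lp lm : R) : c != 0 ->
  (forall P : set R, nbhs lp P -> \forall x \near z, 0 < c * (x - z) -> P (f x)) ->
  (forall P : set R, nbhs lm P -> \forall x \near z, 0 < - c * (x - z) -> P (f x)) ->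
  [/\ cvg (f x @[x --> z^'+]), cvg (f x @[x --> z^'-])
    & lim (f x @[x --> z^'+]) - lim (f x @[x --> z^'-]) = Num.sg c * (lp - lm)].
Proof.
move=> c0 Hp Hm.
have R1 (k l : R) : 0 < k ->
    (forall P : set R, nbhs l P -> \forall x \near z, 0 < k * (x - z) -> P (f x)) ->
    f x @[x --> z^'+] --> l.
  move=> k0 H P /H nP; suff : \forall x \near z^'+, P (f x) by [].
  near=> x; have : 0 < k * (x - z) -> P (f x) by near: x; exact: cvg_within nP.
  by apply; rewrite mulr_gt0// subr_gt0; near: x; exact: nbhs_right_gt.
have L1 (k l : R) : k < 0 ->
    (forall P : set R, nbhs l P -> \forall x \near z, 0 < k * (x - z) -> P (f x)) ->
    f x @[x --> z^'-] --> l.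
  move=> k0 H P /H nP; suff : \forall x \near z^'-, P (f x) by [].
  near=> x; have : 0 < k * (x - z) -> P (f x) by near: x; exact: cvg_within nP.
  by apply; rewrite nmulr_rgt0// subr_lt0; near: x; exact: nbhs_left_lt.
have [c_gt0|c_lt0|] := ltgtP 0 c; last by move=> cE; move: c0; rewrite -cE eqxx.
- have Fr := R1 _ _ c_gt0 Hp.
  have Fl : f x @[x --> z^'-] --> lm by apply: L1 Hm; rewrite oppr_lt0.
  split; [by apply/cvg_ex; exists lp|by apply/cvg_ex; exists lm|].
  by rewrite (cvg_lim _ Fr)// (cvg_lim _ Fl)// gtr0_sg// mul1r.
- have Fl := L1 _ _ c_lt0 Hp.
  have Fr : f x @[x --> z^'+] --> lm by apply: R1 Hm; rewrite oppr_gt0.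
  split; [by apply/cvg_ex; exists lm|by apply/cvg_ex; exists lp|].
  by rewrite (cvg_lim _ Fr)// (cvg_lim _ Fl)// ltr0_sg// mulN1r opprB.
Unshelve. all: by end_near.
Qed.

End coordinate_slices.

(** * Integration over the elements *)

Section plane_measure.
Context {R : realType}.
Notation mu := (@lebesgue_measure R).
Notation plane := (measurableTypeR R * measurableTypeR R)%type.
Implicit Types (A : set plane) (f : plane -> R).

(** The plane carries the product sigma-algebra, so an open set is written as the countable union of
    the boxes with rational corners that it contains. *)
Lemma open_measurable_plane A : open (A : set (pt R)) -> measurable A.
Proof.
move=> oA.
pose box (q : (rat * rat) * (rat * rat)) : set plane :=
  `]ratr q.1.1, ratr q.1.2[%classic `*` `]ratr q.2.1, ratr q.2.2[%classic.
have mbox q : measurable (box q) by apply: measurableX; exact: measurable_itv.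
have -> : A = \bigcup_q (if `[< box q `<=` A >] then box q else set0).
  apply/seteqP; split => [x Ax|x [q _]]; last by case: ifPn => // /asboolP; exact.
  have : \forall y \near (x : pt R), A y by apply: open_nbhs_nbhs.
  move=> /near_boxP[d d0 dA].
  have [q1 q1P] : exists q : rat * rat, [/\ x.1 - d < ratr q.1, ratr q.1 < x.1,
      x.1 < ratr q.2 & ratr q.2 < x.1 + d].
    have /rat_in_itvoo[q] : x.1 - d < x.1 by rewrite gtrBl.
    have /rat_in_itvoo[q'] : x.1 < x.1 + d by rewrite ltrDl.
    rewrite !in_itv/= => /andP[? ?] /andP[? ?]; by exists (q, q').
  have [q2 q2P] : exists q : rat * rat, [/\ x.2 - d < ratr q.1, ratr q.1 < x.2,
      x.2 < ratr q.2 & ratr q.2 < x.2 + d].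
    have /rat_in_itvoo[q] : x.2 - d < x.2 by rewrite gtrBl.
    have /rat_in_itvoo[q'] : x.2 < x.2 + d by rewrite ltrDl.
    rewrite !in_itv/= => /andP[? ?] /andP[? ?]; by exists (q, q').
  case: q1P => ? ? ? ?; case: q2P => ? ? ? ?.
  exists (q1, q2) => //; case: asboolP => [_|[]].
    by split; rewrite /= in_itv/=; apply/andP.
  move=> y [/=]; rewrite !in_itv/= => /andP[? ?] /andP[? ?].
  by apply: dA; rewrite ltr_distl; apply/andP; split; lra.
apply: countable_bigcupT_measurable => [|q]; first exact: countableP.
by case: ifPn.
Qed.

Lemma closed_measurable_plane A : closed (A : set (pt R)) -> measurable A.
Proof.
move=> cA; rewrite -[A]setCK; apply: measurableC; apply: open_measurable_plane.
by rewrite openC.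
Qed.

Lemma open_continuous_measurable_plane A f : open (A : set (pt R)) ->
  (forall x, A x -> {for (x : pt R), continuous (f : pt R -> R)}) -> measurable_fun A f.
Proof.
move=> oA cf; apply: (measurability _ (RGenOpens.measurableE R)).
move=> _ [_ [a [b ->] <-]]; apply: open_measurable_plane.
rewrite openE => x [Ax fx]; rewrite /interior.
have nA : \forall y \near (x : pt R), A y by apply: open_nbhs_nbhs.
have nf : \forall y \near (x : pt R), (`]a, b[%classic) (f y).
  by apply: (cf x Ax); apply: open_nbhs_nbhs; split => //; exact: interval_open.
by apply: filterS2 nA nf.
Qed.

(** A vertical segment lies in a null vertical line; any other segment has at most one point on each
    vertical line. *)
Lemma segment_negligible (a b : pt R) : a != b -> @leb2 R (segment a b) = 0%E.
Proof.
move=> ab.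
have ms : measurable (segment a b : set plane).
  by apply: closed_measurable_plane; exact: closed_segment_pt.
have [ab1|ab1] := eqVneq a.1 b.1.
  have m1 : measurable ([set a.1] `*` setT : set plane) by apply: measurableX.
  apply/eqP; rewrite eq_le measure_ge0 andbT.
  have <- : @leb2 R ([set a.1] `*` setT) = 0%E.
    by rewrite /leb2 product_measure1E//= lebesgue_measure_set1 mul0e.
  apply: le_measure; rewrite ?inE//.
  move=> _ [s _ <-]; split => //=; rewrite -ab1.
  by rewrite -[LHS]/((1 - s) * a.1 + s * a.1); ring.
rewrite /leb2/= /product_measure1/= integral0_eq// => x _ /=.
pose s := (x - a.1) / (b.1 - a.1).
have b0 : b.1 - a.1 != 0 by rewrite subr_eq0 eq_sym.
apply/eqP; rewrite eq_le measure_ge0 andbT.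
rewrite -[leRHS](lebesgue_measure_set1 (a.2 + s * (b.2 - a.2))).
apply: le_measure; rewrite ?inE//; first exact: measurable_xsection.
move=> y; rewrite /xsection/= inE => -[t _] /(congr1 (fun p : pt R => (p.1, p.2))).
move=> [] tx ty.
have {}tx : (1 - t) * a.1 + t * b.1 = x by [].
have {}ty : (1 - t) * a.2 + t * b.2 = y by [].
have -> : s = t by rewrite /s -tx; field.
by rewrite -ty; ring.
Qed.

Lemma bounded_plane_integrable f (U : set plane) (C M : R) :
  measurable U -> measurable_fun U f -> (forall x, U x -> `|f x| <= C) ->
  (forall x, U x -> f x != 0 -> `|x.1| <= M /\ `|x.2| <= M) ->
  (@leb2 R).-integrable U (EFin \o f).
Proof.
move=> mU mf fC fM.
pose I : set (measurableTypeR R) := `[- M, M]%classic.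
pose B : set plane := I `*` I.
have mB : measurable B by apply: measurableX; exact: measurable_itv.
have mUB : measurable (U `&` B) by exact: measurableI.
have B0 : @leb2 R B = (mu I * mu I)%E.
  by rewrite /leb2 product_measure1E//=; exact: measurable_itv.
have Bfin : (@leb2 R B < +oo)%E.
  by rewrite B0 /= /I lebesgue_measure_itv/=; case: ifPn => _; rewrite ?mul0e// -EFinB -EFinM ltry.
have iUB : (@leb2 R).-integrable (U `&` B) (EFin \o f).
  apply: measurable_bounded_integrable => //.
  - by apply: le_lt_trans Bfin; apply: le_measure; rewrite ?inE//; exact: subIsetr.
  - exact: measurable_funS mf.
  - by exists C; split; [exact: num_real|move=> D CD x [Ux _]; exact: le_trans (fC x Ux) (ltW CD)].
have := (integrable_restrict (@leb2 R) mB mU (EFin \o f)).1 iUB.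
apply: eq_integrable => // x; rewrite inE => Ux; rewrite patchE; case: ifPn => //.
rewrite notin_setE => nB /=; congr EFin; apply/esym/eqP; apply: contrapT => /negP fx0.
apply: nB; have [x1 x2] := fM x Ux fx0.
by split; rewrite /= /I /= in_itv/= -ler_norml.
Qed.

End plane_measure.

(** * The integral of a partial derivative as a sum of edge jumps *)

Section planar_divergence.
Context {R : realType} (Omega : set (pt R)) (Th Eh : set (set (pt R))).
Hypotheses (hOmega : polygon Omega) (hmesh : polygonal_mesh Omega Th Eh).
Variables (S : set (pt R)) (M : R).
Hypotheses (cS : closed S) (SO : S `<=` Omega) (M0 : 0 < M).
Hypothesis SM : forall p, S p -> `|p.1| < M /\ `|p.2| < M.
Variables (es : seq (set (pt R))) (a b n : set (pt R) -> pt R).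
Hypotheses (us : uniq es) (esE : Eh = [set` es]).
Hypothesis hab : forall e, Eh e -> a e != b e /\ e = segment (a e) (b e).
Hypothesis hn : forall e, Eh e -> unit_normal e (n e).
Notation mu := (@lebesgue_measure R).
Implicit Types (q D : pt R -> R) (p : pt R).

Let U : set (pt R) := \bigcup_(K in Th) K.

Let gam e := edge_point (a e) (b e).

Lemma elements_open : open U.
Proof.
by apply: bigcup_open => K /(mesh_polygon hmesh)/polygon_open.
Qed.

Lemma piecewise_continuous_at q p : piecewise_continuous Th q -> U p ->
  {for p, continuous q}.
Proof.
move=> pq [K ThK Kp].
have [g [_ qg gK _]] := piecewise_trace_ext pq ThK.
have oK : open K by move: ThK => /(mesh_polygon hmesh)/polygon_open.
have nK : \forall y \near p, K y by apply: open_nbhs_nbhs.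
suff : q x @[x --> p] --> q p by [].
rewrite qg//; have gp := gK p (subset_closure Kp).
move=> P nP; have H : \forall y \near p, K y -> P (q y) by exact: gp nP.
suff : \forall y \near p, P (q y) by [].
by apply: filterS2 nK H => y Ky; apply.
Qed.

Let Ees e : e \in es -> Eh e. Proof. by rewrite esE. Qed.

Let hn' e : Eh e -> unit_normal (segment (a e) (b e)) (n e).
Proof. by move=> Ee; rewrite -(hab Ee).2; exact: hn. Qed.

Let Ee' e : Eh e -> Eh (segment (a e) (b e)).
Proof. by move=> Ee; rewrite -(hab Ee).2. Qed.

Lemma edge_points_distinct e e' (s s' : R) : Eh e -> Eh e' -> s \in `]0, 1[ -> s' \in `]0, 1[ ->
  gam e s = gam e' s' -> e = e'.
Proof.
move=> Ee Ee'_ s01 s'01 ss'; apply: contrapT => ee'.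
have [p1 np1] := segment_interior_point (hab Ee).1 s01.
have [p2 np2] := segment_interior_point (hab Ee'_).1 s'01.
have ep : e (gam e s) by rewrite [X in X _](hab Ee).2.
have e'p : e' (gam e s) by rewrite ss' [X in X _](hab Ee'_).2.
have [epe _] := mesh_conforming hmesh Ee Ee'_ ee' (conj ep e'p).
by apply: np1; rewrite -(hab Ee).2.
Qed.

Section component.
Variables (q D : pt R -> R).
Hypotheses (pq : piecewise_continuous Th q) (sq : supported_in S q).
Hypotheses (pD : piecewise_continuous Th D) (sD : supported_in S D).

(** [D] is controlled on the open elements only. Setting it to zero elsewhere gives a bounded
    measurable density on the whole plane, with the same one-sided limits at edges. *)
Let D0 := D \_ U.

Let D0U p : U p -> D0 p = D p.
Proof. by move=> Up; rewrite /D0 patchE mem_set. Qed.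

Let pD0 : piecewise_continuous Th D0.
Proof.
move=> K ThK; have [[g [cg Dg]] _] := pD ThK; split => //; exists g; split => // x Kx.
by rewrite D0U ?Dg//; exists K.
Qed.

Let sD0 : supported_in S D0.
Proof. by move=> x nSx; rewrite /D0 patchE; case: ifPn => // _; exact: sD. Qed.

(** A point of [S] off the edges is inside an element because the mesh covers [Omega]; off [S] both
    functions vanish nearby. So along a line regularity can fail only at edges. *)
Let off_edges p : ~ (\bigcup_(e in Eh) e) p ->
  U p \/ \forall y \near p, q y = 0 /\ D0 y = 0.
Proof.
move=> Np; have [Sp|nSp] := pselect (S p).
  by left; have [] := Omega_cover hmesh (SO Sp).
by right; apply: filterS2 (supported_near cS sq nSp) (supported_near cS sD0 nSp).
Qed.

Lemma integrable_piecewise : (@leb2 R).-integrable U (EFin \o D).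
Proof.
have [C C0 DC] := piecewise_mesh_bounded hmesh pD.
apply: (@bounded_plane_integrable _ _ _ C M) => //.
- by apply: open_measurable_plane; exact: elements_open.
- apply: open_continuous_measurable_plane; first exact: elements_open.
  by move=> x; exact: piecewise_continuous_at.
- move=> x Ux; have [Sx _|nSx] := pselect (S x); last by rewrite sD// eqxx.
  by have [/ltW ? /ltW ?] := SM Sx.
Qed.

Let iD0 : (@leb2 R).-integrable setT (EFin \o D0).
Proof.
rewrite /D0 -restrict_EFin; apply/integrable_restrict => //=.
  by apply: open_measurable_plane; exact: elements_open.
by rewrite setTI; exact: integrable_piecewise.
Qed.

Let mD0 : measurable_fun (setT : set (measurableTypeR R * measurableTypeR R)) D0.
Proof. by apply/measurable_EFinP; exact: measurable_int iD0. Qed.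

Let bD0 : exists2 C : R, 0 < C & forall x, `|D0 x| <= C.
Proof.
have [C C0 DC] := piecewise_mesh_bounded hmesh pD; exists C => // x.
rewrite /D0 patchE; case: ifPn => [|_]; last by rewrite normr0 ltW.
by rewrite inE => /DC.
Qed.

Let bounded_slice_integrable (f : R -> R) (C : R) : measurable_fun setT f ->
  (forall x : R, `|f x| <= C) -> (forall x : R, M <= `|x| -> f x = 0) ->
  mu.-integrable setT (EFin \o f).
Proof.
move=> mf fC fM.
have -> : f = f \_ `[- M, M].
  apply/funext => x; rewrite patchE; case: ifPn => //.
  rewrite notin_setE/= in_itv/= -ler_norml => /negP; rewrite -ltNge => xM.
  by rewrite fM// ltW.
rewrite -restrict_EFin; apply/integrable_restrict => //=; rewrite setTI.
apply: measurable_bounded_integrable => //.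
- by rewrite /= lebesgue_measure_itv/=; case: ifPn; rewrite -?EFinB ltry.
- exact: measurable_funTS.
- by exists C; split; [exact: num_real|move=> N CN x _; exact: le_trans (fC x) (ltW CN)].
Qed.

Let jump_integrable e (k : R) : Eh e ->
  mu.-integrable setT (EFin \o ((fun s => k * jump (n e) q (gam e s)) \_ `]0, 1[)).
Proof.
move=> Ee.
have ij := integrable_jump hOmega hmesh cS SO (hab Ee).1 (Ee' Ee) (hn' Ee) pq sq.
apply: eq_integrable (integrableZl measurableT k ij) => // s _ /=.
by rewrite !patchE; case: ifPn => _; rewrite -EFinM ?mulr0.
Qed.

Let outside p : M <= `|p.1| \/ M <= `|p.2| -> q p = 0 /\ D0 p = 0.
Proof.
move=> pM; have nSp : ~ S p.
  by move=> /SM[p1 p2]; case: pM; rewrite leNgt ?p1 ?p2.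
by rewrite sq// sD0.
Qed.

Let half_lim_preimage f e (s : R) (P : set R) m : piecewise_continuous Th f ->
  supported_in S f -> Eh e -> s \in `]0, 1[ -> m = n e \/ m = - n e ->
  nbhs (half_lim m f (gam e s)) P -> half_nbhs m (gam e s) (f @^-1` P).
Proof.
move=> pf sf Ee s01 mE nP.
have hm : unit_normal (segment (a e) (b e)) m.
  by case: mE => ->; [exact: hn'|exact/unit_normalN/hn'].
exact: (cvg_half_lim hOmega hmesh cS SO (hab Ee).1 (Ee' Ee) hm pf sf s01 nP).
Qed.

Let not_on_edges (p : pt R) :
  (forall e (s : R), e \in es -> s \in `[0, 1] -> gam e s <> p) ->
  ~ (\bigcup_(e in Eh) e) p.
Proof.
move=> H [e Ee]; rewrite {1}(hab Ee).2 => -[s s01 sp].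
by apply: (H e s) => //; move: Ee; rewrite esE.
Qed.

Lemma tangential_length e : Eh e ->
  let c := dot (tangent (n e)) (b e - a e) in
  (b e).1 - (a e).1 = - c * (n e).2 /\ (b e).2 - (a e).2 = c * (n e).1.
Proof.
by move=> /hn' hne; apply: orthogonal_tangent; [case: hne|exact: unit_normal_segment].
Qed.

Let integral_D0 : \int[@leb2 R]_(x in U) D x = fine (\int[@leb2 R]_x (D0 x)%:E)%E.
Proof.
rewrite /Rintegral integral_mkcond; congr fine; apply: eq_integral => x _.
by rewrite /D0 restrict_EFin.
Qed.

(** Slicing weights an edge by its extent across the lines and by the sign of a normal component. As
    [b e - a e] is a multiple of the unit tangent, these combine into the length of the edge times
    that component, as in the divergence theorem. *)
Let edge_sum (i : pt R -> R) (w : set (pt R) -> R) :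
  (forall e, Eh e -> `|w e| * Num.sg (i (n e)) =
      `|dot (tangent (n e)) (b e - a e)| * i (n e)) ->
  \sum_(e <- es) `|w e| * \int[mu]_(s in `]0, 1[) (Num.sg (i (n e)) * jump (n e) q (gam e s)) =
  \sum_(e <- es) `|dot (tangent (n e)) (b e - a e)| *
     (i (n e) * \int[mu]_(s in `]0, 1[) jump (n e) q (gam e s)).
Proof.
move=> wE; apply: eq_big_seq => e /Ees Ee.
rewrite RintegralZl//; first by rewrite !mulrA wE.
have := jump_integrable 1 Ee; rewrite -restrict_EFin => /integrable_restrict.
rewrite setTI => /(_ (measurable_itv _) measurableT).
by apply: eq_integrable => // s _ /=; rewrite mul1r.
Qed.

(** One coordinate of the divergence theorem: after Fubini, [q] restricted to a horizontal line is a
    primitive of [D0] away from the edges. Jumps are oriented by [n e], whichever way the line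
    crosses the edge. *)
Lemma integral_pderiv1_jump :
  (forall x, U x -> is_derive x (basis_vec R 0) q (D x)) ->
  \int[@leb2 R]_(x in U) D x = - \sum_(e <- es)
     `|dot (tangent (n e)) (b e - a e)| *
       ((n e).1 * \int[mu]_(s in `]0, 1[) jump (n e) q (gam e s)).
Proof.
move=> qD.
have bs (t y : R) : (0, y) + t *: basis_vec R 0 = (t, y) :> pt R.
  by rewrite [LHS]surjective_pairing/=; congr pair;
    rewrite -[t *: _]/(t * _) /= ?mulr1 ?mulr0 ?addr0 ?add0r.
have [C C0 D0C] := bD0.
have iDs (y : R) : mu.-integrable setT (EFin \o (fun x => D0 (x, y))).
  apply: (bounded_slice_integrable (C := C)) => //.
  - exact: measurableT_comp mD0 _.
  - by move=> x xM; have [] := @outside (x, y) (or_introl xM).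
have inner y : (\int[mu]_x (D0 (x, y))%:E)%E = (\int[mu]_x D0 (x, y))%:E.
  by rewrite fineK//; exact: (integrable_fin_num _ (iDs y)).
have mG := measurable_fubini_G iD0.
have mint : measurable_fun setT (fun y => \int[mu]_x D0 (x, y)).
  exact: measurableT_comp mG.
rewrite -(edge_sum (i := fst) (w := fun e => (b e).2 - (a e).2)); last first.
  move=> e Ee; rewrite (tangential_length Ee).2 normrM -mulrA; congr (_ * _).
  by rewrite mulrC -numEsg.
rewrite integral_D0 -(integral21_prod_meas1 iD0).
rewrite -(@integral_slices R _ es a b (fun x y => q (x, y)) (fun x y => D0 (x, y))
  (fun e s => Num.sg (n e).1 * jump (n e) q (gam e s)) M)//.
- by rewrite /Rintegral; congr fine; apply: eq_integral => y _; exact: inner.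
- move=> x y /not_on_edges/off_edges[Up|near0].
  + split.
    * have := qD _ Up; rewrite -[X in is_derive X](bs x y) => /is_derive_line.
      by rewrite D0U// (funext (fun t => congr1 q (bs t y))).
    * have cxy : {for (x, y) : pt R, continuous D0}.
        apply: piecewise_continuous_at => //.
      apply: (@continuous_comp _ _ _ (fun x : R => (x, y) : pt R) D0) => //.
      by rewrite -(funext (fun t => bs t y)); exact: continuous_affine_pt.
  + have nx : \forall z \near x, q (z, y) = 0 /\ D0 (z, y) = 0.
      have cp : continuous (fun x : R => (x, y) : pt R).
        by rewrite -(funext (fun t => bs t y)); exact: continuous_affine_pt.
      exact: (cp x _ near0).
    have [qxy Dxy] := nbhs_singleton near0; rewrite Dxy; split.
    * apply: near_eq_is_derive (is_derive_cst (0 : R) x 1).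
      by apply: filterS nx => z [-> _].
    * suff : D0 (z, y) @[z --> x] --> (0 : R) by rewrite -Dxy.
      apply: cvg_near_cst.
      by apply: filterS nx => z [_ ->].
- by move=> e e' s s' /Ees Ee /Ees Ee''; exact: edge_points_distinct.
- move=> e s /Ees Ee s01 ab2 p.
  have c0 : (n e).1 != 0.
    apply: contraNneq ab2 => n10; have [_ /eqP] := tangential_length Ee.
    by rewrite n10 mulr0 subr_eq0 eq_sym.
  have lims f : piecewise_continuous Th f -> supported_in S f ->
    [/\ cvg (f (x, p.2) @[x --> p.1^'+]), cvg (f (x, p.2) @[x --> p.1^'-])
    & lim (f (x, p.2) @[x --> p.1^'+]) - lim (f (x, p.2) @[x --> p.1^'-]) =
      Num.sg (n e).1 * jump (n e) f p].
    move=> pf sf; apply: slice_limits => // P nP.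
    - exact: (half_nbhs_slice1 (half_lim_preimage pf sf Ee s01 (or_introl erefl) nP)).
    - exact: (half_nbhs_slice1 (half_lim_preimage pf sf Ee s01 (or_intror erefl) nP)).
  have [? ? _] := lims D0 pD0 sD0; have [? ? E] := lims q pq sq.
  by split => //; rewrite E.
- by move=> x y xM; exact: (@outside (x, y) (or_introl xM)).
- by move=> e /Ees Ee; exact: jump_integrable.
Qed.

Lemma integral_pderiv2_jump :
  (forall x, U x -> is_derive x (basis_vec R 1) q (D x)) ->
  \int[@leb2 R]_(x in U) D x = - \sum_(e <- es)
     `|dot (tangent (n e)) (b e - a e)| *
       ((n e).2 * \int[mu]_(s in `]0, 1[) jump (n e) q (gam e s)).
Proof.
move=> qD.
have bs (t y : R) : (y, 0) + t *: basis_vec R 1 = (y, t) :> pt R.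
  by rewrite [LHS]surjective_pairing/=; congr pair;
    rewrite -[t *: _]/(t * _) /= ?mulr1 ?mulr0 ?addr0 ?add0r.
have [C C0 D0C] := bD0.
have iDs (y : R) : mu.-integrable setT (EFin \o (fun x => D0 (y, x))).
  apply: (bounded_slice_integrable (C := C)) => //.
  - exact: measurableT_comp mD0 _.
  - by move=> x xM; have [] := @outside (y, x) (or_intror xM).
have inner y : (\int[mu]_x (D0 (y, x))%:E)%E = (\int[mu]_x D0 (y, x))%:E.
  by rewrite fineK//; exact: (integrable_fin_num _ (iDs y)).
have mG := measurable_fubini_F iD0.
have mint : measurable_fun setT (fun y => \int[mu]_x D0 (y, x)).
  exact: measurableT_comp mG.
rewrite -(edge_sum (i := snd) (w := fun e => (b e).1 - (a e).1)); last first.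
  move=> e Ee; rewrite (tangential_length Ee).1 normrM normrN -mulrA; congr (_ * _).
  by rewrite mulrC -numEsg.
rewrite integral_D0 -(integral12_prod_meas1 iD0).
(* The segments and functions are reflected in the diagonal, so that vertical lines play the part of
   horizontal ones. *)
rewrite -(@integral_slices R _ es (fun e => ((a e).2, (a e).1)) (fun e => ((b e).2, (b e).1))
  (fun x y => q (y, x)) (fun x y => D0 (y, x))
  (fun e s => Num.sg (n e).2 * jump (n e) q (gam e s)) M)//.
- by rewrite /Rintegral; congr fine; apply: eq_integral => y _; exact: inner.
- move=> x y H; have /not_on_edges/off_edges[Up|near0] :
      forall e (s : R), e \in es -> s \in `[0, 1] -> gam e s <> (y, x).
    move=> e s ees s01 gE; apply: (H e s ees s01).
    by rewrite -[LHS]/((gam e s).2, (gam e s).1) gE.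
  + split.
    * have := qD _ Up; rewrite -[X in is_derive X](bs x y) => /is_derive_line.
      by rewrite D0U// (funext (fun t => congr1 q (bs t y))).
    * have cxy : {for (y, x) : pt R, continuous D0}.
        apply: piecewise_continuous_at => //.
      apply: (@continuous_comp _ _ _ (fun x : R => (y, x) : pt R) D0) => //.
      by rewrite -(funext (fun t => bs t y)); exact: continuous_affine_pt.
  + have nx : \forall z \near x, q (y, z) = 0 /\ D0 (y, z) = 0.
      have cp : continuous (fun x : R => (y, x) : pt R).
        by rewrite -(funext (fun t => bs t y)); exact: continuous_affine_pt.
      exact: (cp x _ near0).
    have [qxy Dxy] := nbhs_singleton near0; rewrite Dxy; split.
    * apply: near_eq_is_derive (is_derive_cst (0 : R) x 1).
      by apply: filterS nx => z [-> _].
    * suff : D0 (y, z) @[z --> x] --> (0 : R) by rewrite -Dxy.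
      apply: cvg_near_cst.
      by apply: filterS nx => z [_ ->].
- move=> e e' s s' /Ees Ee /Ees Ee'' s01 s'01 gE.
  apply: (edge_points_distinct Ee Ee'' s01 s'01).
  by rewrite [LHS]surjective_pairing [RHS]surjective_pairing;
    congr pair; [exact: (congr1 snd gE)|exact: (congr1 fst gE)].
- move=> e s /Ees Ee s01 ab2 p'.
  pose p := gam e s.
  have c0 : (n e).2 != 0.
    apply: contraNneq ab2 => n10; have [/eqP + _] := tangential_length Ee.
    by rewrite n10 mulr0 subr_eq0 eq_sym.
  have lims f : piecewise_continuous Th f -> supported_in S f ->
    [/\ cvg (f (p.1, x) @[x --> p.2^'+]), cvg (f (p.1, x) @[x --> p.2^'-])
    & lim (f (p.1, x) @[x --> p.2^'+]) - lim (f (p.1, x) @[x --> p.2^'-]) =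
      Num.sg (n e).2 * jump (n e) f p].
    move=> pf sf; apply: slice_limits => // P nP.
    - exact: (half_nbhs_slice2 (half_lim_preimage pf sf Ee s01 (or_introl erefl) nP)).
    - exact: (half_nbhs_slice2 (half_lim_preimage pf sf Ee s01 (or_intror erefl) nP)).
  have [? ? _] := lims D0 pD0 sD0; have [? ? E] := lims q pq sq.
  by split => //; rewrite E.
- by move=> x y xM; exact: (@outside (y, x) (or_intror xM)).
- by move=> e /Ees Ee; exact: jump_integrable.
Qed.

End component.

End planar_divergence.

(** * The Green identity *)

Section smooth_functions.
Context {R : realType}.
Implicit Types (phi g : pt R -> R) (S : set (pt R)).

Lemma sum_ord2 (F : 'I_2 -> R) : \sum_i F i = F 0 + F 1.
Proof.
by rewrite !big_ord_recl big_ord0 addr0; congr (F _ + F _); exact: val_inj.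
Qed.

Lemma formE (u v : pt R) (A : 'M[R]_2) : Defs.form u A v =
  u.1 * A 0 0 * v.1 + u.1 * A 0 1 * v.2 + (u.2 * A 1 0 * v.1 + u.2 * A 1 1 * v.2).
Proof. by rewrite /Defs.form !sum_ord2. Qed.

Lemma Ck2_continuous phi : Ck 2 phi ->
  [/\ continuous phi, forall i x, derivable phi x (basis_vec R i),
      forall i, continuous (pderiv i phi),
      forall i j x, derivable (pderiv i phi) x (basis_vec R j)
    & forall i j, continuous (pderiv j (pderiv i phi))].
Proof.
move=> [c0 H]; split => //.
- by move=> i x; have [d _] := H i.
- by move=> i; have [_ [+ _]] := H i.
- by move=> i j; have [_ [_ /(_ j)[+ _]]] := H i.
- by move=> i j; have [_ [_ /(_ j)[_ [+ _]]]] := H i.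
Qed.

Lemma supported_pderiv S g i : closed S -> supported_in S g -> supported_in S (pderiv i g).
Proof.
move=> cS sg x nSx; have n0 := supported_near cS sg nSx.
rewrite /pderiv (near_eq_derive (g := cst 0)); first exact: derive_cst.
exact: n0.
Qed.

Lemma compact_box S : compact S -> exists2 M : R, 0 < M &
  forall p, S p -> `|p.1| < M /\ `|p.2| < M.
Proof.
move=> /compact_bounded[M [_ SM]]; exists (`|M| + 2); first by rewrite ltr_wpDl.
move=> p Sp; have : Num.max `|p.1| `|p.2| <= `|M| + 1.
  by apply: (SM (`|M| + 1)) => //; rewrite (le_lt_trans (ler_norm _))// ltrDl.
by rewrite ge_max => /andP[p1 p2]; split;
  [apply: le_lt_trans p1 _|apply: le_lt_trans p2 _]; rewrite ltrD2l ltr1n.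
Qed.

Lemma Lfun2_of_sqr_integrable d (T : measurableType d) (m : {measure set T -> \bar R})
  (f : T -> R) : measurable_fun setT f ->
  m.-integrable setT (EFin \o (fun x => f x ^+ 2)) -> f \in Lfun m 2%:E.
Proof.
move=> mf /integrableP[_ fi]; rewrite inE; apply/andP; split; rewrite inE//=.
rewrite /finite_norm unlock poweR_lty//; apply: le_lt_trans fi.
rewrite le_eqVlt; apply/orP; left; apply/eqP; apply: eq_integral => x _ /=.
by rewrite normrX powR_mulrn.
Qed.

End smooth_functions.

Section traces.
Context {R : realType} (Th : set (set (pt R))).
Implicit Types (u v : pt R -> R) (K : set (pt R)) (p : pt R).

Lemma piecewise_continuous_eq u v : (forall x, (\bigcup_(K in Th) K) x -> u x = v x) ->
  piecewise_continuous Th u -> piecewise_continuous Th v.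
Proof.
move=> uv pu K ThK; have [[g [cg ug]] _] := pu K ThK; split => //; exists g; split => //.
by move=> x Kx; rewrite -uv ?ug//; exists K.
Qed.

Lemma piecewise_continuousZ (c : R) u : piecewise_continuous Th u ->
  piecewise_continuous Th (fun x => c * u x).
Proof.
move=> pu; apply: piecewise_continuousM => //; apply: continuous_piecewise.
exact: cst_continuous.
Qed.

Lemma trace_from_cvg K u v p (l : R) : closure K p -> (forall x, K x -> u x = v x) ->
  v y @[y --> within K (nbhs p)] --> l -> trace_from K u p = l.
Proof.
move=> Kp uv vl; have PF := closure_within_proper Kp.
apply/cvg_lim => //; apply: cvg_trans vl; apply: near_eq_cvg.
by apply: (@filterE _ (nbhs p)) => x Kx; rewrite uv.
Qed.

End traces.

Section pointwise_derivatives.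
Context {R : realType} (x v : pt R) (f g : pt R -> R) (df dg : R).

Lemma is_derive_pointwiseD : is_derive x v f df -> is_derive x v g dg ->
  is_derive x v (fun y => f y + g y) (df + dg).
Proof. by move=> Df Dg; exact: is_deriveD. Qed.

Lemma is_derive_pointwiseB : is_derive x v f df -> is_derive x v g dg ->
  is_derive x v (fun y => f y - g y) (df - dg).
Proof. by move=> Df Dg; exact: is_deriveB. Qed.

Lemma is_derive_pointwiseM : is_derive x v f df -> is_derive x v g dg ->
  is_derive x v (fun y => f y * g y) (df * g x + f x * dg).
Proof.
move=> Df Dg; apply: is_derive_eq (is_deriveM Df Dg) _.
by rewrite -[LHS]/(f x * dg + g x * df); ring.
Qed.

Lemma is_derive_pointwiseZ (c : R) : is_derive x v f df ->
  is_derive x v (fun y => c * f y) (c * df).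
Proof. by move=> Df; exact: is_deriveZ. Qed.

End pointwise_derivatives.

Section green_identity.
Context {R : realType} (Omega : set (pt R)) (Th Eh : set (set (pt R))).
Variables (n : set (pt R) -> pt R) (tau : pt R -> 'M[R]_2).
Hypotheses (hOmega : polygon Omega) (hmesh : polygonal_mesh Omega Th Eh).
Hypothesis hn : forall e, Eh e -> unit_normal e (n e).
Hypothesis hsmooth : forall K, Th K -> forall i j, Ck_closure 2 K (fun x => tau x i j).
Hypothesis hnn : forall e, interior_edges Omega Eh e ->
  L2_single_valued_edge Th e (nn_comp (n e) tau).
Hypothesis htn : forall e, interior_edges Omega Eh e ->
  L2_single_valued_edge Th e (tn_div_comp (n e) tau).
Hypothesis hvertex : forall d, interior_vertices Omega Eh d ->
  single_valued_vertex Th d tau.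
Variable phi : pt R -> R.
Hypothesis hphi : test_function Omega phi.
Implicit Types (K : set (pt R)) (p x : pt R).
Notation mu := (@lebesgue_measure R).
Notation pc := (piecewise_continuous Th).

Let U : set (pt R) := \bigcup_(K in Th) K.
Let S : set (pt R) := closure [set x | phi x != 0].

(* The components and their partial derivatives are variables rather than local
   definitions so that unification cannot unfold them. *)
Variables (T : 'I_2 -> 'I_2 -> pt R -> R) (dT : 'I_2 -> 'I_2 -> 'I_2 -> pt R -> R)
  (ddT : 'I_2 -> 'I_2 -> 'I_2 -> 'I_2 -> pt R -> R)
  (dphi : 'I_2 -> pt R -> R) (ddphi : 'I_2 -> 'I_2 -> pt R -> R).
Hypotheses (TE : forall i j, (fun x => tau x i j) = T i j)
  (dTE : forall k i j, pderiv k (T i j) = dT k i j)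
  (ddTE : forall l k i j, pderiv l (dT k i j) = ddT l k i j)
  (dphiE : forall i, pderiv i phi = dphi i)
  (ddphiE : forall j i, pderiv j (dphi i) = ddphi j i).

Let cS : closed S. Proof. exact: closed_closure. Qed.

Let SO : S `<=` Omega. Proof. by case: hphi. Qed.

Let C2phi := Ck2_continuous (let: And3 H _ _ := hphi in H 2%N).

Let sphi : supported_in S phi.
Proof.
move=> x nSx; apply/eqP; apply: contrapT => /negP px; apply: nSx.
exact: subset_closure.
Qed.

Let sdphi i : supported_in S (dphi i).
Proof. by rewrite -dphiE; exact: supported_pderiv. Qed.

Let sddphi j i : supported_in S (ddphi j i).
Proof. by rewrite -ddphiE; apply: supported_pderiv => //; exact: sdphi. Qed.

Let pphi : pc phi. Proof. by apply: continuous_piecewise; case: C2phi. Qed.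

Let pdphi i : pc (dphi i).
Proof. by rewrite -dphiE; apply: continuous_piecewise; case: C2phi => _ _ /(_ i). Qed.

Let pddphi j i : pc (ddphi j i).
Proof.
by rewrite -ddphiE -dphiE; apply: continuous_piecewise; case: C2phi => _ _ _ _ /(_ i j).
Qed.

Let pT i j : pc (T i j).
Proof. by rewrite -TE => K ThK; have [g _] := hsmooth ThK i j. Qed.

Let pdT k i j : pc (dT k i j).
Proof.
by rewrite -dTE -TE => K ThK; have [_ /(_ k)[_ [g _]]] := hsmooth ThK i j.
Qed.

Let pddT l k i j : pc (ddT l k i j).
Proof.
by rewrite -ddTE -dTE -TE => K ThK;
  have [_ /(_ k)[_ [_ /(_ l)[_ ?]]]] := hsmooth ThK i j.
Qed.

Let DT k i j x : U x -> is_derive x (basis_vec R k) (T i j) (dT k i j x).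
Proof.
rewrite -dTE -TE => -[K ThK Kx].
have [_ /(_ k)[+ _]] := hsmooth ThK i j => /(_ x Kx).
exact: derivableP.
Qed.

Let DdT l k i j x : U x -> is_derive x (basis_vec R l) (dT k i j) (ddT l k i j x).
Proof.
rewrite -ddTE -dTE -TE => -[K ThK Kx].
have [_ /(_ k)[_ [_ /(_ l)[+ _]]]] := hsmooth ThK i j => /(_ x Kx).
exact: derivableP.
Qed.

Let Dphi k x : is_derive x (basis_vec R k) phi (dphi k x).
Proof. by rewrite -dphiE; have [_ + _ _ _] := C2phi => /(_ k x)/derivableP. Qed.

Let Ddphi l k x : is_derive x (basis_vec R l) (dphi k) (ddphi l k x).
Proof.
by rewrite -ddphiE -dphiE; have [_ _ _ + _] := C2phi => /(_ k l x)/derivableP.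
Qed.

Let oU : open U. Proof. exact: (elements_open hmesh). Qed.

Let DTw i j x w : U x -> is_derive x w (T i j) (w.1 * dT 0 i j x + w.2 * dT 1 i j x).
Proof.
move=> Ux; rewrite -!dTE; apply: is_derive_direction.
- have : \forall y \near x, U y by apply: open_nbhs_nbhs.
  by apply: filterS => y /DT Dy k; case: (Dy k i j).
- by move=> k; rewrite dTE; exact: (piecewise_continuous_at hmesh (@pdT k i j) Ux).
Qed.

Let Dphiw x w : is_derive x w phi (w.1 * dphi 0 x + w.2 * dphi 1 x).
Proof.
rewrite -!dphiE; apply: is_derive_direction.
- by apply: (@filterE _ (nbhs x)) => y k; case: (Dphi k y).
- by move=> k; case: C2phi => _ _ /(_ k) + _ _; exact.
Qed.

(* The flux [tau grad phi - (div tau) phi], written without using the symmetry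
   of [tau]; its piecewise divergence is [tau : Hess phi - (div div tau) phi]. *)
Let q i x : R := T 0 i x * dphi 0 x + T 1 i x * dphi 1 x
  - (dT 0 i 0 x + dT 1 i 1 x) * phi x.

Let D i x : R := dT i 0 i x * dphi 0 x + T 0 i x * ddphi i 0 x
  + (dT i 1 i x * dphi 1 x + T 1 i x * ddphi i 1 x)
  - ((ddT i 0 i 0 x + ddT i 1 i 1 x) * phi x + (dT 0 i 0 x + dT 1 i 1 x) * dphi i x).

Let pq i : pc (q i).
Proof.
apply: piecewise_continuousD; last apply: piecewise_continuousN.
  by apply: piecewise_continuousD; apply: piecewise_continuousM.
by apply: piecewise_continuousM => //; exact: piecewise_continuousD.
Qed.

Let pD i : pc (D i).
Proof.
apply: piecewise_continuousD; last apply: piecewise_continuousN.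
  by apply: piecewise_continuousD; apply: piecewise_continuousD; apply: piecewise_continuousM.
by apply: piecewise_continuousD; apply: piecewise_continuousM => //;
  exact: piecewise_continuousD.
Qed.

Let sq i : supported_in S (q i).
Proof.
by move=> x nSx; rewrite /q sphi// (sdphi 0 nSx) (sdphi 1 nSx) !mulr0 addr0 subr0.
Qed.

Let sD i : supported_in S (D i).
Proof.
move=> x nSx; rewrite /D sphi// (sdphi 0 nSx) (sdphi 1 nSx) (sdphi i nSx).
by rewrite (sddphi i 0 nSx) (sddphi i 1 nSx) !mulr0 !addr0 subr0.
Qed.

Let Dq i x : U x -> is_derive x (basis_vec R i) (q i) (D i x).
Proof.
move=> Ux; apply: is_derive_pointwiseB.
  by apply: is_derive_pointwiseD; apply: is_derive_pointwiseM => //; exact: DT.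
apply: is_derive_pointwiseM => //.
by apply: is_derive_pointwiseD; exact: DdT.
Qed.

Let eta : pt R -> R := fun x => \sum_i \sum_j ddT i j i j x.

Let petaE x : eta x = ddT 0 0 0 0 x + ddT 0 1 0 1 x + (ddT 1 0 1 0 x + ddT 1 1 1 1 x).
Proof. exact: etrans (sum_ord2 _) (congr2 _ (sum_ord2 _) (sum_ord2 _)). Qed.

(** With [q i] the sum over [k] of [T k i * dphi k] minus [(dT 0 i 0 + dT 1 i 1) * phi], the
    products of first derivatives cancel in pairs once the two components are added. *)
Let divq x : D 0 x + D 1 x = T 0 0 x * ddphi 0 0 x + T 1 0 x * ddphi 0 1 x
  + (T 0 1 x * ddphi 1 0 x + T 1 1 x * ddphi 1 1 x) - eta x * phi x.
Proof. by rewrite petaE /D; ring. Qed.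

(** * The flux across one edge *)

Section edge.
Variables (a b m : pt R).
Hypotheses (ab : a != b) (Ee : Eh (segment a b)) (hm : unit_normal (segment a b) m).
Hypothesis hmn : m = n (segment a b).
Let t := tangent m.
Let w : pt R := b - a.
Let c := dot t w.

Let m1 : m.1 * m.1 + m.2 * m.2 = 1. Proof. by rewrite -dotE; case: hm. Qed.

Let wE : w.1 = - c * m.2 /\ w.2 = c * m.1.
Proof.
by apply: orthogonal_tangent; [case: hm|exact: unit_normal_segment].
Qed.

Let c0 : c != 0.
Proof.
apply: contraNneq ab => cE; have [w1 w2] := wE.
rewrite eq_sym -subr_eq0; apply/eqP.
by rewrite -/w [w]surjective_pairing w1 w2 cE oppr0 !mul0r.
Qed.

Let tn x : R := t.1 * m.1 * T 0 0 x + t.1 * m.2 * T 0 1 x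
  + (t.2 * m.1 * T 1 0 x + t.2 * m.2 * T 1 1 x).

Let dtn k x : R := t.1 * m.1 * dT k 0 0 x + t.1 * m.2 * dT k 0 1 x
  + (t.2 * m.1 * dT k 1 0 x + t.2 * m.2 * dT k 1 1 x).

Let tnE x : Defs.form t (tau x) m = tn x.
Proof.
have tE i j : tau x i j = T i j x by rewrite -TE.
by rewrite formE /tn !tE; ring.
Qed.

Let ptn : pc tn.
Proof.
by apply: piecewise_continuousD; apply: piecewise_continuousD; apply: piecewise_continuousZ.
Qed.

Let pdtn k : pc (dtn k).
Proof.
by apply: piecewise_continuousD; apply: piecewise_continuousD; apply: piecewise_continuousZ.
Qed.

Let Dtn x v : U x -> is_derive x v tn (v.1 * dtn 0 x + v.2 * dtn 1 x).
Proof.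
move=> Ux.
have H : is_derive x v tn (t.1 * m.1 * (v.1 * dT 0 0 0 x + v.2 * dT 1 0 0 x)
   + t.1 * m.2 * (v.1 * dT 0 0 1 x + v.2 * dT 1 0 1 x)
   + (t.2 * m.1 * (v.1 * dT 0 1 0 x + v.2 * dT 1 1 0 x)
   + t.2 * m.2 * (v.1 * dT 0 1 1 x + v.2 * dT 1 1 1 x))).
  by apply: is_derive_pointwiseD; apply: is_derive_pointwiseD;
    apply: is_derive_pointwiseZ; exact: DTw.
by apply: is_derive_eq H _; rewrite /dtn; ring.
Qed.

Let nn x : R := m.1 * m.1 * T 0 0 x + m.1 * m.2 * T 0 1 x
  + (m.2 * m.1 * T 1 0 x + m.2 * m.2 * T 1 1 x).

Let nnE x : nn_comp m tau x = nn x.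
Proof.
have tE i j : tau x i j = T i j x by rewrite -TE.
by rewrite /nn_comp formE /nn !tE; ring.
Qed.

Let pnn : pc (nn_comp m tau).
Proof.
apply: (piecewise_continuous_eq (u := nn)) => [x _|]; first by rewrite nnE.
by apply: piecewise_continuousD; apply: piecewise_continuousD; apply: piecewise_continuousZ.
Qed.

Let td x : R := t.1 * dtn 0 x + t.2 * dtn 1 x
  + (m.1 * (dT 0 0 0 x + dT 1 0 1 x) + m.2 * (dT 0 1 0 x + dT 1 1 1 x)).

Let tdE x : U x -> tn_div_comp m tau x = td x.
Proof.
move=> Ux; rewrite /tn_div_comp /td dotE /row_div /= !sum_ord2 !TE !dTE; congr (_ + _).
have -> : (fun y => Defs.form (tangent m) (tau y) m) = tn by apply/funext => y; exact: tnE.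
by case: (Dtn t Ux).
Qed.

Let ptd : pc (tn_div_comp m tau).
Proof.
apply: (piecewise_continuous_eq (u := td)) => [x Ux|]; first by rewrite tdE.
apply: piecewise_continuousD.
  by apply: piecewise_continuousD; apply: piecewise_continuousZ.
by apply: piecewise_continuousD; apply: piecewise_continuousZ; apply: piecewise_continuousD.
Qed.

Let u x : R := tn x * phi x.

Let du x : R := (w.1 * dtn 0 x + w.2 * dtn 1 x) * phi x
  + tn x * (w.1 * dphi 0 x + w.2 * dphi 1 x).

Let pu : pc u. Proof. exact: piecewise_continuousM. Qed.

Let su : supported_in S u.
Proof. by move=> x nSx; rewrite /u sphi// mulr0. Qed.

Let pdu : pc du.
Proof.
by apply: piecewise_continuousD; apply: piecewise_continuousM => //;
  apply: piecewise_continuousD; apply: piecewise_continuousZ.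
Qed.

Let sdu : supported_in S du.
Proof.
by move=> x nSx; rewrite /du sphi// (sdphi 0 nSx) (sdphi 1 nSx) !(mulr0, addr0).
Qed.

Let Du x : U x -> is_derive x w u (du x).
Proof.
move=> Ux; apply: is_derive_pointwiseM; first exact: Dtn.
exact: Dphiw.
Qed.

Let dnphi x : R := m.1 * dphi 0 x + m.2 * dphi 1 x.

(** Splitting the gradient of [phi] along [m] and [t] turns the normal flux into normal-normal,
    tangential and divergence terms. The factor [c] appears because [u] is differentiated along
    [w = c t], the velocity of the edge parametrization. *)
Let fluxE x : c * (m.1 * q 0 x + m.2 * q 1 x) - du x =
  c * (nn x * dnphi x - td x * phi x).
Proof.
have [w1 w2] := wE; rewrite /du w1 w2 /q /nn /td /tn /dnphi /dtn /t /tangent /=.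
apply/eqP; rewrite -subr_eq0; apply/eqP.
(* As polynomials the two sides differ by this multiple of [1 - |m|^2], which is 0 for a unit
   normal. *)
transitivity ((1 - (m.1 * m.1 + m.2 * m.2)) * c *
   ((m.1 * T 0 0 x + m.2 * T 0 1 x) * dphi 0 x
     + (m.1 * T 1 0 x + m.2 * T 1 1 x) * dphi 1 x)); last by rewrite m1 subrr !mul0r.
by ring.
Qed.

(** [fluxE] becomes a statement about [tn_div_comp] only inside the elements; it reaches the edge by
    uniqueness of limits from [K]. *)
Let trace_flux K p : Th K -> closure K p ->
  c * (m.1 * trace_from K (q 0) p + m.2 * trace_from K (q 1) p) - trace_from K du p =
  c * (trace_from K (nn_comp m tau) p * dnphi p - trace_from K (tn_div_comp m tau) p * phi p).
Proof.
move=> ThK Kp.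
have tr f : pc f -> f y @[y --> within K (nbhs p)] --> trace_from K f p.
  by move=> pf; exact: (piecewise_trace pf ThK Kp).
have cw (f : pt R -> R) : continuous f -> f y @[y --> within K (nbhs p)] --> f p.
  by move=> cf; apply: cvg_within_filter; exact: cf.
have L1 : (c * (m.1 * q 0 y + m.2 * q 1 y) - du y) @[y --> within K (nbhs p)] -->
    c * (m.1 * trace_from K (q 0) p + m.2 * trace_from K (q 1) p) - trace_from K du p.
  apply: cvgB; last exact: tr.
  by apply: cvgMr; apply: cvgD; apply: cvgMr; apply: tr; exact: pq.
have [cphi _ cdphi _ _] := C2phi.
have L2 : (c * (nn_comp m tau y * dnphi y - tn_div_comp m tau y * phi y))
    @[y --> within K (nbhs p)] -->
  c * (trace_from K (nn_comp m tau) p * dnphi p - trace_from K (tn_div_comp m tau) p * phi p).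
  apply: cvgMr; apply: cvgB; apply: cvgM; [exact: tr| |exact: tr|exact: cw].
  apply: cw => x; apply: cvgD; apply: cvgMr; rewrite -dphiE; exact: cdphi.
rewrite -(trace_from_cvg Kp (fun x _ => erefl) L1).
apply: (trace_from_cvg Kp _ L2) => x Kx.
by rewrite fluxE nnE tdE//; exists K.
Qed.

(** At a point outside [S] everything is 0. A point in [S] is in [Omega], so the edge is interior
    and (ii) and (iii) give the right-hand side of [trace_flux] the same value from both adjacent
    elements. *)
Let jump_flux (s : R) : s \in `]0, 1[ -> let p := edge_point a b s in
  c * (m.1 * jump m (q 0) p + m.2 * jump m (q 1) p) = jump m du p.
Proof.
move=> s01 p.
have hmN : unit_normal (segment a b) (- m) by exact: unit_normalN.
have [Sp|nSp] := pselect (S p); last first.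
  have z f k : supported_in S f -> unit_normal (segment a b) k -> half_lim k f p = 0.
    move=> sf hk; have /half_nbhs_proper PF := hk.1.
    by apply/cvg_lim => //; exact/half_lim0/(supported_near cS sf nSp).
  by rewrite /jump !z// subrr !mulr0 addr0 mulr0.
have Op := SO Sp.
have [K [ThK eK nK]] := half_neighborhood_edge hOmega hmesh ab Ee hm s01 Op.
have [K' [ThK' eK' nK']] := half_neighborhood_edge hOmega hmesh ab Ee hmN s01 Op.
have tr f : pc f -> half_lim m f p = trace_from K f p.
  by move=> pf; exact: (half_lim_trace hm pf s01 ThK eK nK).
have tr' f : pc f -> half_lim (- m) f p = trace_from K' f p.
  by move=> pf; exact: (half_lim_trace hmN pf s01 ThK' eK' nK').
have [ep nep] := segment_interior_point ab s01.
have ie : interior_edges Omega Eh (segment a b).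
  split => // /(_ _ ep)[_]; rewrite (interior_id Omega).1; first by apply.
  exact: polygon_open.
have Kp : closure K p by exact: eK.
have K'p : closure K' p by exact: eK'.
have enn : trace_from K (nn_comp m tau) p = trace_from K' (nn_comp m tau) p.
  by rewrite hmn; apply: (hnn ie).2.
have etd : trace_from K (tn_div_comp m tau) p = trace_from K' (tn_div_comp m tau) p.
  by rewrite hmn; apply: (htn ie).2.
have E := trace_flux ThK Kp; have E' := trace_flux ThK' K'p.
rewrite -enn -etd in E'; rewrite -E in E'.
rewrite /jump !(tr, tr')//.
apply/eqP; rewrite -subr_eq0; apply/eqP.
have {}E' := esym (etrans E' erefl).
transitivity ((c * (m.1 * trace_from K (q 0) p + m.2 * trace_from K (q 1) p) - trace_from K du p)
 - (c * (m.1 * trace_from K' (q 0) p + m.2 * trace_from K' (q 1) p) - trace_from K' du p)).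
  by ring.
by rewrite E' subrr.
Qed.

(** An endpoint in [S] is an interior vertex. The limit is computed from any element [K0] at [p],
    and (iv), entry by entry, makes it the same from all others. *)
Let vertex_limit p : p = a \/ p = b -> S p ->
  exists l : R, forall K, Th K -> closure K p -> u y @[y --> within K (nbhs p)] --> l.
Proof.
move=> pab Sp; have Op := SO Sp.
have [K0 ThK0 K0p] : (\bigcup_(K in Th) closure K) p.
  by rewrite -(mesh_cover hmesh); exact: subset_closure.
have ivp : interior_vertices Omega Eh p.
  split.
    by exists (segment a b) => //; rewrite endpoints_segment.
  move=> [_]; rewrite (interior_id Omega).1; first by apply.
  exact: polygon_open.
have [cphi _ _ _ _] := C2phi.
pose L K := (t.1 * m.1 * trace_from K (T 0 0) p + t.1 * m.2 * trace_from K (T 0 1) p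
  + (t.2 * m.1 * trace_from K (T 1 0) p + t.2 * m.2 * trace_from K (T 1 1) p)) * phi p.
exists (L K0) => K ThK Kp.
have -> : L K0 = L K by rewrite /L -!TE !(hvertex ivp ThK0 ThK K0p Kp).
have tr i j : T i j y @[y --> within K (nbhs p)] --> trace_from K (T i j) p.
  exact: (piecewise_trace (@pT i j) ThK Kp).
apply: cvgM; last by apply: cvg_within_filter; exact: cphi.
by apply: cvgD; apply: cvgD; apply: cvgMr; exact: tr.
Qed.

Lemma edge_flux_zero :
  m.1 * \int[mu]_(s in `]0, 1[) jump m (q 0) (edge_point a b s)
  + m.2 * \int[mu]_(s in `]0, 1[) jump m (q 1) (edge_point a b s) = 0.
Proof.
have ij i : mu.-integrable `]0, 1[ (EFin \o (fun s => jump m (q i) (edge_point a b s))).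
  have := integrable_jump hOmega hmesh cS SO ab Ee hm (@pq i) (@sq i).
  by rewrite -restrict_EFin => /integrable_restrict; rewrite setTI; apply.
have ij' (k : R) i : mu.-integrable `]0, 1[ (EFin \o (fun s => k * jump m (q i)
    (edge_point a b s))).
  by apply: eq_integrable (integrableZl _ k (ij i)).
apply: (mulfI c0); rewrite mulr0.
rewrite -!RintegralZl// -RintegralD// -RintegralZl//; last first.
  by apply: eq_integrable (integrableD _ (ij' m.1 0) (ij' m.2 1)).
apply: etrans (integral_jump_tangential hOmega hmesh cS SO ab Ee hm pu su pdu sdu Du
  vertex_limit).
by apply: eq_Rintegral => s; rewrite inE/= => s01; exact: jump_flux.
Qed.

End edge.

Let ieta : piecewise_continuous Th eta.
Proof.
apply: (piecewise_continuous_eq (u := fun x => ddT 0 0 0 0 x + ddT 0 1 0 1 x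
  + (ddT 1 0 1 0 x + ddT 1 1 1 1 x))) => [x _|]; first by rewrite petaE.
by apply: piecewise_continuousD; apply: piecewise_continuousD.
Qed.

Lemma green_elements :
  \int[@leb2 R]_(x in U) (T 0 0 x * ddphi 0 0 x + T 1 0 x * ddphi 0 1 x
    + (T 0 1 x * ddphi 1 0 x + T 1 1 x * ddphi 1 1 x)) =
  \int[@leb2 R]_(x in U) (eta x * phi x).
Proof.
have [M M0 SM] : exists2 M : R, 0 < M & forall p, S p -> `|p.1| < M /\ `|p.2| < M.
  by apply: compact_box; case: hphi.
have /finite_seqP[es0 es0E] := (mesh_finite hmesh).2.
(* Each edge has to be counted once in the sum of jumps. *)
pose es := undup es0.
have esE : Eh = [set` es].
  by rewrite es0E; apply/seteqP; split => e /=; rewrite mem_undup.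
have /choice[ab abP] : forall e, exists p : pt R * pt R,
    Eh e -> p.1 != p.2 /\ e = segment p.1 p.2.
  move=> e; have [Ee|nEe] := pselect (Eh e); last by exists (0, 0).
  by have [a [b [ab eE]]] := mesh_segment hmesh Ee; exists (a, b).
have iD i : (@leb2 R).-integrable U (EFin \o D i).
  exact: (integrable_piecewise hmesh SM (@pD i) (@sD i)).
have iep : (@leb2 R).-integrable U (EFin \o (fun x => eta x * phi x)).
  apply: (integrable_piecewise hmesh SM).
  - exact: piecewise_continuousM.
  - by move=> x nSx; rewrite sphi// mulr0.
have I1 := integral_pderiv1_jump hOmega hmesh cS SO M0 SM (undup_uniq es0) esE abP hn
  (@pq 0) (@sq 0) (@pD 0) (@sD 0) (@Dq 0).
have I2 := integral_pderiv2_jump hOmega hmesh cS SO M0 SM (undup_uniq es0) esE abP hn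
  (@pq 1) (@sq 1) (@pD 1) (@sD 1) (@Dq 1).
have mU : measurable (U : set (measurableTypeR R * measurableTypeR R)).
  exact: open_measurable_plane.
have ID : \int[@leb2 R]_(x in U) (D 0 x + D 1 x) = 0.
  rewrite RintegralD// I1 I2 -opprD -big_split/= big1_seq ?oppr0// => e /andP[_ ees].
  have Ee : Eh e by rewrite esE.
  have [ab' eE] := abP e Ee.
  (* Both coordinate formulas weight this edge by the same length, so the two contributions add up
     to a multiple of its total normal flux. *)
  rewrite -mulrDr; have -> := edge_flux_zero ab' _ _ (_ : n e = n (segment (ab e).1 (ab e).2)).
  - by rewrite mulr0.
  - by rewrite -eE.
  - by rewrite -eE; exact: hn.
  - by rewrite -eE.
transitivity (\int[@leb2 R]_(x in U) (D 0 x + D 1 x + eta x * phi x)).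
  by apply: eq_Rintegral => x _; rewrite divq subrK.
rewrite RintegralD//; first by rewrite ID add0r.
by apply: eq_integrable (integrableD mU (iD 0) (iD 1)).
Qed.

End green_identity.

(** The entries [T i j] are measurable only after extension by zero from [A], so the extension is
    moved from the whole sum to these factors. *)
Lemma measurable_contraction (R : realType) d (X : measurableType d) (A : set X)
    (T g : 'I_2 -> 'I_2 -> X -> R) :
  (forall i j, measurable_fun setT (T i j \_ A)) ->
  (forall i j, measurable_fun setT (g i j)) ->
  measurable_fun setT ((fun x => \sum_i \sum_j T i j x * g i j x) \_ A).
Proof.
move=> mT mg.
rewrite (_ : _ \_ A = fun x => \sum_i \sum_j (T i j \_ A) x * g i j x); last first.
  apply/funext => x; rewrite patchE; case: ifPn => xA.
    by apply: eq_bigr => i _; apply: eq_bigr => j _; rewrite patchE xA.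
  rewrite big1// => i _; rewrite big1// => j _.
  by rewrite patchE (negbTE xA) mul0r.
apply: measurable_sum => i; apply: measurable_sum => j.
by apply: measurable_funM.
Qed.

(** * Passage from the elements to the whole domain *)

Section mesh_measure.
Context {R : realType} (Omega : set (pt R)) (Th Eh : set (set (pt R))).
Hypotheses (hOmega : polygon Omega) (hmesh : polygonal_mesh Omega Th Eh).
Notation plane := (measurableTypeR R * measurableTypeR R)%type.

Lemma edges_negligible : (@leb2 R).-negligible (\bigcup_(e in Eh) e).
Proof.
have /finite_seqP[es esE] := (mesh_finite hmesh).2.
have : forall e, e \in es -> (@leb2 R).-negligible e.
  move=> e ees; have [a [b [ab ->]]] : is_segment e.
    by apply: (mesh_segment hmesh); rewrite esE.
  apply/negligibleP; last exact: segment_negligible.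
  by apply: closed_measurable_plane; exact: closed_segment_pt.
rewrite esE; elim: es {esE} => [_|e es IHes H].
  rewrite (_ : \bigcup_(e in _) e = set0); first exact: negligible_set0.
  by apply/seteqP; split => x // -[].
have : (@leb2 R).-negligible (e `|` \bigcup_(e' in [set` es]) e'); last apply: negligibleS.
  apply: negligibleU; first by apply: H; rewrite inE eqxx.
  by apply: IHes => e' e'es; apply: H; rewrite inE e'es orbT.
move=> x [e']; rewrite /= inE => /orP[/eqP-> ex|e'es e'x]; first by left.
by right; exists e'.
Qed.

(** The elements lie in [Omega] and miss only points of edges, which form a null set. *)
Lemma integral_Omega_elements (F G : pt R -> R) :
  measurable_fun (setT : set plane) (F \_ Omega) ->
  measurable_fun (setT : set plane) (G \_ (\bigcup_(K in Th) K)) ->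
  (forall x, (\bigcup_(K in Th) K) x -> F x = G x) ->
  \int[@leb2 R]_(x in Omega) F x = \int[@leb2 R]_(x in \bigcup_(K in Th) K) G x.
Proof.
move=> mF mG FG; rewrite [LHS]Rintegral_mkcond [RHS]Rintegral_mkcond; congr fine.
apply: ae_eq_integral => //; [exact/measurable_EFinP|exact/measurable_EFinP|].
apply: negligibleS edges_negligible => x /=; apply: contra_notP => Nx _.
rewrite !patchE; case: ifPn => [|]; rewrite ?inE ?notin_setE => Ox.
  have [Ux|//] := Omega_cover hmesh Ox.
  by rewrite mem_set// FG.
rewrite ifF//; apply/negbTE; rewrite notin_setE => -[K ThK Kx].
by apply: Ox; exact: (element_sub_Omega hOmega hmesh ThK Kx).
Qed.

Lemma elements_L2 (f : pt R -> R) : piecewise_continuous Th f ->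
  L2 Omega (f \_ (\bigcup_(K in Th) K)).
Proof.
move=> pf; set U := \bigcup_(K in Th) K.
have UO : U `<=` Omega by move=> x [K ThK]; exact: (element_sub_Omega hOmega hmesh ThK).
rewrite /L2 -patch_setI (setIidr UO).
have oU : open U by exact: (elements_open hmesh).
have mU : measurable (U : set plane) by exact: open_measurable_plane.
have mf : measurable_fun (U : set plane) f.
  apply: open_continuous_measurable_plane => // x Ux.
  exact: (piecewise_continuous_at hmesh pf Ux).
have mfU : measurable_fun (setT : set plane) (f \_ U) by apply/(measurable_restrictT f mU).
apply: Lfun2_of_sqr_integrable => //.
have [C C0 fC] := piecewise_mesh_bounded hmesh pf.
have [M M0 OM] : exists2 M : R, 0 < M & forall p, closure Omega p -> `|p.1| < M /\ `|p.2| < M.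
  by apply/compact_box/compact_closure_bounded; case: hOmega.
apply: (@bounded_plane_integrable _ _ _ (C ^+ 2) M) => //.
- exact: measurable_funX.
- move=> x _; rewrite patchE; case: ifPn => [|_]; last by rewrite expr0n normr0 sqr_ge0.
  by rewrite inE => /fC fx; rewrite normrX lerXn2r ?nnegrE// ltW.
- move=> x _; rewrite patchE; case: ifPn => [|_]; last by rewrite expr0n eqxx.
  rewrite inE => /UO Ox _; have [/ltW ? /ltW ?] := OM x (subset_closure Ox).
  by split.
Qed.

End mesh_measure.

Theorem lemma2p5 (R : realType) (Omega : set (pt R)) (Th Eh : set (set (pt R)))
  (n : set (pt R) -> pt R) (tau : pt R -> 'M[R]_2)
  (hOmega : polygon Omega)
  (hmesh : polygonal_mesh Omega Th Eh)
  (hn : forall e, Eh e -> unit_normal e (n e))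
  (htau : L2_sym Omega tau)
  (hsmooth : forall K, Th K -> forall i j, Ck_closure 2 K (fun x => tau x i j))
  (hi : forall K, Th K -> Hdivdiv K tau)
  (hii : forall e, interior_edges Omega Eh e ->
     L2_single_valued_edge Th e (nn_comp (n e) tau))
  (hiii : forall e, interior_edges Omega Eh e ->
     L2_single_valued_edge Th e (tn_div_comp (n e) tau))
  (hiv : forall d, interior_vertices Omega Eh d ->
     single_valued_vertex Th d tau) :
  Hdivdiv Omega tau.
Proof.
split; first exact: htau.
pose U : set (pt R) := \bigcup_(K in Th) K.
pose eta (x : pt R) : R :=
  \sum_i \sum_j pderiv i (pderiv j (fun y => tau y i j)) x.
have UO : U `<=` Omega by move=> x [K ThK]; exact: (element_sub_Omega hOmega hmesh ThK).
have oU : open U by exact: (elements_open hmesh).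
have mU : measurable (U : set (measurableTypeR R * measurableTypeR R)).
  exact: open_measurable_plane.
have pdd i j : piecewise_continuous Th (pderiv i (pderiv j (fun y => tau y i j))).
  by move=> K ThK; have [_ /(_ j)[_ [_ /(_ i)[_ ?]]]] := hsmooth K ThK i j.
have peta : piecewise_continuous Th eta.
  apply: (piecewise_continuous_eq (u := fun x =>
     pderiv 0 (pderiv 0 (fun y => tau y 0 0)) x + pderiv 0 (pderiv 1 (fun y => tau y 0 1)) x
   + (pderiv 1 (pderiv 0 (fun y => tau y 1 0)) x + pderiv 1 (pderiv 1 (fun y => tau y 1 1)) x))).
    move=> x _; apply/esym.
    exact: etrans (sum_ord2 _) (congr2 _ (sum_ord2 _) (sum_ord2 _)).
  by apply: piecewise_continuousD; apply: piecewise_continuousD; exact: pdd.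
(* On the edges [eta] is built from derivatives that carry no information, so it is replaced by zero
   on this null set; on the elements it is bounded. *)
exists (eta \_ U); first exact: (elements_L2 hOmega hmesh peta).
move=> phi hphi.
have [cphi _ cdphi _ cddphi] := Ck2_continuous (let: And3 H _ _ := hphi in H 2%N).
have mcont (g : pt R -> R) : continuous g ->
    measurable_fun (setT : set (measurableTypeR R * measurableTypeR R)) g.
  by move=> cg; apply: open_continuous_measurable_plane; [exact: openT|move=> x _; exact: cg].
(* The integrand delivered by [green_elements], with [tau] transposed in the contraction with the
   Hessian. Symmetry of [tau] identifies it with the integrand of [divdiv_distr]. *)
pose h x := tau x 0 0 * pderiv 0 (pderiv 0 phi) x + tau x 1 0 * pderiv 0 (pderiv 1 phi) x
  + (tau x 0 1 * pderiv 1 (pderiv 0 phi) x + tau x 1 1 * pderiv 1 (pderiv 1 phi) x).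
have mpiece g : piecewise_continuous Th g ->
    measurable_fun (setT : set (measurableTypeR R * measurableTypeR R)) (g \_ U).
  move=> pg; apply/(measurable_restrictT g mU).
  apply: open_continuous_measurable_plane => // x Ux.
  exact: (piecewise_continuous_at hmesh pg Ux).
have ptau i j : piecewise_continuous Th (fun x => tau x i j).
  by move=> K ThK; have [g _] := hsmooth K ThK i j.
have ph : piecewise_continuous Th h.
  by apply: piecewise_continuousD; apply: piecewise_continuousD;
    apply: piecewise_continuousM => //; apply: continuous_piecewise; exact: cddphi.
have tsym x i j : Omega x -> tau x i j = tau x j i.
  by move=> Ox; rewrite -[in RHS](htau.1 x Ox) mxE.
have mtau i j : measurable_fun (setT : set (measurableTypeR R * measurableTypeR R))
    ((fun x => tau x i j) \_ Omega).
  by have /sub_Lfun_mfun := htau.2 i j; rewrite inE.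
have hE : \int[@leb2 R]_(x in Omega) (\sum_i \sum_j tau x i j * pderiv i (pderiv j phi) x)
    = \int[@leb2 R]_(x in U) h x.
  apply: (integral_Omega_elements hOmega hmesh); last 2 first.
  - exact: mpiece.
  - move=> x /UO Ox;
    apply: etrans (etrans (sum_ord2 _) (congr2 _ (sum_ord2 _) (sum_ord2 _))) _.
    by rewrite /h (tsym x 1 0 Ox).
  apply: (measurable_contraction (T := fun i j x => tau x i j)
    (g := fun i j => pderiv i (pderiv j phi))); first exact: mtau.
  by move=> i j; apply: mcont; exact: cddphi.
rewrite /divdiv_distr hE.
have -> := @green_elements R Omega Th Eh n tau hOmega hmesh hn hsmooth hii hiii hiv phi hphi
    (fun i j x => tau x i j) (fun k i j => pderiv k (fun x => tau x i j))
    (fun l k i j => pderiv l (pderiv k (fun x => tau x i j)))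
    (fun i => pderiv i phi) (fun j i => pderiv j (pderiv i phi))
    (fun _ _ => erefl) (fun _ _ _ => erefl) (fun _ _ _ _ => erefl)
    (fun _ => erefl) (fun _ _ => erefl).
have pep : piecewise_continuous Th (fun x => eta x * phi x).
  by apply: piecewise_continuousM => //; exact: continuous_piecewise.
apply/esym; apply: (integral_Omega_elements hOmega hmesh).
- rewrite (_ : _ \_ Omega = (fun x => eta x * phi x) \_ U); first exact: mpiece.
  apply/funext => x; rewrite !patchE; case: ifPn; case: ifPn => //; rewrite ?mul0r//.
  by rewrite inE notin_setE => /UO Ox.
- exact: mpiece.
- by move=> x Ux; rewrite patchE mem_set.
Qed.
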